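(* Let $\theta:\mathbb{R}\to\mathbb{R}$ be continuous. If $u$ is a solution of $$u_t-\operatorname{tr}\left[\left(I-\frac{\nabla_H u\otimes\nabla_H u}{|\nabla_H u|^2}\right)(\nabla_H^2u)^\ast\right]=0\quad\text{in }\mathcal{H}\times(0,\infty),$$ then $w=\theta\circ u$ is also a solution of this equation in $\mathcal{H}\times(0,\infty)$.
   Context: The Heisenberg group $\mathcal{H}$ is $\mathbb{R}^3$ with the multiplication $(p_1,p_2,p_3)\cdot(q_1,q_2,q_3)=(p_1+q_1,\,p_2+q_2,\,p_3+q_3+\tfrac12(p_1q_2-q_1p_2))$ (usual topology of $\mathbb{R}^3$). Set $X_1=\partial_{p_1}-\tfrac{p_2}{2}\partial_{p_3}$, $X_2=\partial_{p_2}+\tfrac{p_1}{2}\partial_{p_3}$, $\nabla_Hu=(X_1u,X_2u)$, and let $(\nabla_H^2u)^\ast$ be the symmetric $2\times2$ matrix with diagonal entries $X_1^2u$, $X_2^2u$ and off-diagonal entries $\tfrac12(X_1X_2u+X_2X_1u)$. Solutions are in the viscosity sense. For $\eta\in\mathbb{R}^2\setminus\{0\}$ and a symmetric $2\times 2$ matrix $Y$ put $F(\eta,Y)=-\operatorname{tr}\big((I-\frac{\eta\otimes\eta}{|\eta|^2})Y\big)$. Let $\mathcal{O}\subset\mathcal{H}\times(0,\infty)$ be open. An upper (resp. lower) semicontinuous, extended-real-valued function $u$ on $\mathcal{O}$ is a subsolution (resp. supersolution) in $\mathcal{O}$ of $u_t+F(\nabla_Hu,(\nabla_H^2u)^\ast)=0$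 if (i) $u<\infty$ (resp. $u>-\infty$) in $\mathcal{O}$; and (ii) whenever $\phi$ is a smooth function on $\mathcal{O}$ and $u-\phi$ attains a (finite) maximum (resp. minimum) over $\mathcal{O}$ at $(\hat p,\hat t)$, then at $(\hat p,\hat t)$: $\phi_t+F(\nabla_H\phi,(\nabla_H^2\phi)^\ast)\le0$ (resp. $\ge0$) if $\nabla_H\phi\ne0$; and $\phi_t\le0$ (resp. $\ge0$) if $\nabla_H\phi=0$ and $(\nabla_H^2\phi)^\ast=0$. A solution is a function that is both a subsolution and a supersolution (hence it is real-valued and continuous). *)

(* Defs.v *)
From HB Require Import structures.
From mathcomp Require Import all_boot all_order all_algebra.
From mathcomp Require Import all_classical all_reals all_analysis.
Set Implicit Arguments.
Unset Strict Implicit.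
Unset Printing Implicit Defensive.
Import Order.TTheory GRing.Theory Num.Theory.
Import numFieldNormedType.Exports.
Local Open Scope classical_set_scope.
Local Open Scope ring_scope.

(* Coordinates are numbered from 0: p_1, p_2, p_3 are p 0 0, p 0 1, p 0 2. *)
Definition heis (R : realType) := 'rV[R]_3.

(* X1 and X2 below are the left-invariant fields for this group law equal to
   d/dp_1 and d/dp_2 at the origin. *)
Definition heis_mul (R : realType) (p q : heis R) : heis R :=
  p + q + (2^-1 * (p 0 0 * q 0 1 - q 0 0 * p 0 1)) *: delta_mx 0 2.

Definition spacetime (R : realType) := (heis R * R)%type.

(* Some i is the direction of p_(i+1), None the direction of t. *)
Definition coord_dir (R : realType) (k : option 'I_3) : spacetime R :=
  if k is Some i then (delta_mx 0 i, 0) else (0, 1).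

Definition partial (R : realType) (k : option 'I_3) (phi : spacetime R -> R) :
  spacetime R -> R := 'D_(coord_dir R k) phi.

(* Functions on an open set O are represented by total functions; only their
   values on O matter. *)
Fixpoint Ck_on (R : realType) (n : nat) (O : set (spacetime R))
    (phi : spacetime R -> R) : Prop :=
  {within O, continuous phi} /\
  if n is m.+1 then
    forall k : option 'I_3,
      (forall x, O x -> derivable phi x (coord_dir R k)) /\
      Ck_on m O (partial k phi)
  else True.

Definition smooth_on (R : realType) (O : set (spacetime R))
    (phi : spacetime R -> R) : Prop := forall n, Ck_on n O phi.

Definition X1 (R : realType) (phi : spacetime R -> R) : spacetime R -> R :=
  fun x => partial (Some 0) phi x - x.1 0 1 / 2 * partial (Some 2) phi x.

Definition X2 (R : realType) (phi : spacetime R -> R) : spacetime R -> R :=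
  fun x => partial (Some 1) phi x + x.1 0 0 / 2 * partial (Some 2) phi x.

Definition horizX (R : realType) (i : 'I_2) :
    (spacetime R -> R) -> spacetime R -> R :=
  if i == 0 then @X1 R else @X2 R.

Definition gradH (R : realType) (phi : spacetime R -> R) (x : spacetime R) :
  'rV[R]_2 := \row_i horizX i phi x.

Definition hessH (R : realType) (phi : spacetime R -> R) (x : spacetime R) :
  'M[R]_2 := \matrix_(i, j)
    (2^-1 * (horizX i (horizX j phi) x + horizX j (horizX i phi) x)).

(* The library norm on row vectors is the sup norm, hence the explicit sum of
   squares for the Euclidean |eta|^2; eta^T *m eta is the tensor square. *)
Definition mcf_op (R : realType) (eta : 'rV[R]_2) (Y : 'M[R]_2) : R :=
  - \tr ((1%:M - (\sum_i eta 0 i ^+ 2)^-1 *: (eta^T *m eta)) *m Y).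

(* As for {within O, continuous u}, using the topology of subspace O makes
   lower_semicontinuous say nothing about points outside O. *)
Definition lsc_on (R : realType) (O : set (spacetime R))
    (u : spacetime R -> \bar R) : Prop :=
  lower_semicontinuous (u : subspace O -> \bar R).

Definition usc_on (R : realType) (O : set (spacetime R))
    (u : spacetime R -> \bar R) : Prop := lsc_on O (fun x => - u x)%E.

Definition finite_max_at (R : realType) (O : set (spacetime R))
    (f : spacetime R -> \bar R) (x : spacetime R) : Prop :=
  [/\ O x, f x \is a fin_num & forall y, O y -> (f y <= f x)%E].

Definition finite_min_at (R : realType) (O : set (spacetime R))
    (f : spacetime R -> \bar R) (x : spacetime R) : Prop :=
  [/\ O x, f x \is a fin_num & forall y, O y -> (f x <= f y)%E].

Definition subsolution (R : realType) (O : set (spacetime R))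
    (u : spacetime R -> \bar R) : Prop :=
  [/\ usc_on O u,
      forall x, O x -> (u x < +oo)%E &
      forall phi x, smooth_on O phi ->
        finite_max_at O (fun y => u y - (phi y)%:E)%E x ->
        (gradH phi x != 0 ->
           partial None phi x + mcf_op (gradH phi x) (hessH phi x) <= 0) /\
        (gradH phi x = 0 -> hessH phi x = 0 -> partial None phi x <= 0)].

Definition supersolution (R : realType) (O : set (spacetime R))
    (u : spacetime R -> \bar R) : Prop :=
  [/\ lsc_on O u,
      forall x, O x -> (-oo < u x)%E &
      forall phi x, smooth_on O phi ->
        finite_min_at O (fun y => u y - (phi y)%:E)%E x ->
        (gradH phi x != 0 ->
           0 <= partial None phi x + mcf_op (gradH phi x) (hessH phi x)) /\
        (gradH phi x = 0 -> hessH phi x = 0 -> 0 <= partial None phi x)].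

Definition solution (R : realType) (O : set (spacetime R))
    (u : spacetime R -> \bar R) : Prop :=
  subsolution O u /\ supersolution O u.

Definition heis_pos_time (R : realType) : set (spacetime R) :=
  [set: heis R] `*` [set t : R | 0 < t].

(* Main.v *)
(** Let theta(u) - phi have a maximum at x0 and put c = u x0. Then u <> c on
    {phi < phi x0}. If the inequality required of phi at x0 fails, some partial
    derivative of phi at x0 is nonzero, so points of this sublevel set near x0 are
    connected inside it, u - c has a constant sign there and, replacing u by -u if
    necessary, {u >= c} is contained in {phi >= phi x0} near
    x0. A Taylor expansion in left-translated coordinates (h, z, tau) replaces phi
    by an explicit coercive function Psi for which {u >= c} meets {Psi <= 0} only
    where Psi is a strict supersolution. For steep increasing T, the maximum of
    u - T(Psi) is attained near that set, and the equation, which is geometric,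
    shows that T(Psi) is still a strict supersolution there: this contradicts
    the subsolution property of u. *)
Require Import Defs.
From mathcomp Require Import all_boot all_order all_algebra.
From mathcomp Require Import all_classical all_reals all_analysis.
From mathcomp Require Import ring lra.
Import Order.TTheory GRing.Theory Num.Theory.
Import numFieldNormedType.Exports.
Local Open Scope classical_set_scope.
Local Open Scope ring_scope.
Set Implicit Arguments.
Unset Strict Implicit.
Unset Printing Implicit Defensive.

(** As [theta] is only continuous, and neither monotone nor smooth, a function touching [theta \o u]
    cannot be turned into one touching u. What survives is that phi >= phi x0 on the level set {u =
    u x0}, and nothing else is used of the maximum. Two obstacles shape the barrier. First, maxima
    are taken over the whole noncompact set H x (0, oo), so every test function has to be coercive:
    the term tau^2 / t in [lq] keeps sublevel sets away from t = 0, and a smooth function above a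
    prescribed sequence dominates u far away. Second, where the gradient of a test function vanishes
    but its Hessian does not, a subsolution satisfies no inequality. So if both vanish for phi, no
    multiple of |h|^2 can be added to make the contact strict. The model then grows in h only like K
    |h|^4, contact is no longer confined to x0, and strictness has to hold near every possible
    contact point; this follows from bounds on K |h|^2 and K |tau|. The supersolution half is the
    subsolution half for - theta, since F(-eta, -Y) = - F(eta, Y). *)

Lemma within_openP (R : realType) (O : set (spacetime R))
    (f : spacetime R -> R) : open O ->
  {within O, continuous f} <-> (forall x, O x -> {for x, continuous f}).
Proof.
move=> oO; rewrite continuous_open_subspace //; split=> H x.
  by move=> Ox; apply: H; rewrite inE.
by rewrite inE; apply: H.
Qed.

Lemma open_heis_pos_time (R : realType) : open (@heis_pos_time R).
Proof.
rewrite /heis_pos_time openE => -[p t] [_ /= t0].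
exists ([set: heis R], [set t : R | 0 < t]) => /=.
  by split; [exact: filterT | exact: lt_nbhsr].
by move=> [q s] [].
Qed.

(** * Directional derivatives as one-variable derivatives along lines *)

Lemma is_derive_line (R : realType) (V : normedModType R) (f : V -> R)
    (x v : V) (df : R) :
  is_derive x v f df <-> is_derive (0 : R) 1 (fun h : R => f (h *: v + x)) df.
Proof.
have E : 'D_v f x = 'D_1 (fun h : R => f (h *: v + x)) 0.
  rewrite /derive; set g1 := fun h => h^-1 *: _; set g2 := fun h => h^-1 *: _.
  suff -> : g1 = g2 by [].
  by rewrite funeqE /g1 /g2 => h /=; rewrite addr0 scale0r add0r [_%:A]mulr1.
split=> -[fd <-]; apply: DeriveDef; rewrite ?E //.
  exact: (derivable1P f x v).1.
exact: (derivable1P f x v).2.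
Qed.

Lemma is_derive_comp1 (R : realType) (V : normedModType R) (f : V -> R)
    (g : R -> R) (x v : V) (df dg : R) :
  is_derive x v f df -> is_derive (f x) 1 g dg ->
  is_derive x v (g \o f) (dg * df).
Proof.
move=> /is_derive_line [fd Ef] [gd Eg]; apply/is_derive_line.
set F := fun h : R => f (h *: v + x) in fd Ef *.
have F0 : F 0 = f x by rewrite /F scale0r add0r.
have gd' : derivable g (F 0) 1 by rewrite F0.
apply: DeriveDef; rewrite -/(g \o F).
  apply/derivable1_diffP/differentiable_comp; exact/derivable1_diffP.
by rewrite -derive1E derive1_comp // F0 !derive1E Ef Eg.
Qed.

Lemma is_derive_affine (R : realType) (a b x : R) :
  is_derive x 1 (fun h : R => a * h + b) a.
Proof.
have H : is_derive x 1 ((a *: (id : R -> R)) + cst b) (a *: 1 + 0).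
  exact: is_deriveD.
by move: H; rewrite addr0 [a *: 1]mulr1.
Qed.

(** * Closure properties of smooth functions on an open set *)

Section Ck_closure.
Context (R : realType) (O : set (spacetime R)).
Hypothesis oO : open O.
Implicit Types f g : spacetime R -> R.

Lemma near_open x : O x -> \forall y \near x, O y.
Proof. by move=> Ox; apply: open_nbhs_nbhs. Qed.

Lemma partial_congr f g k x : (forall y, O y -> f y = g y) -> O x ->
  partial k f x = partial k g x.
Proof.
move=> fg Ox; apply: near_eq_derive; near=> y; apply: fg; near: y.
exact: near_open.
Unshelve. all: by end_near. Qed.

Lemma derivable_congr f g v x : (forall y, O y -> f y = g y) -> O x ->
  derivable f x v -> derivable g x v.
Proof.
move=> fg Ox; apply: near_eq_derivable; near=> y; apply: fg; near: y.
exact: near_open.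
Unshelve. all: by end_near. Qed.

Lemma continuous_congr f g x : (forall y, O y -> f y = g y) -> O x ->
  {for x, continuous f} -> {for x, continuous g}.
Proof.
move=> fg Ox cf; rewrite /prop_for /continuous_at -fg //.
apply: cvg_trans cf; apply: near_eq_cvg; near=> y; apply: fg; near: y.
exact: near_open.
Unshelve. all: by end_near. Qed.

Lemma Ck_on_continuous n f x : Ck_on n O f -> O x -> {for x, continuous f}.
Proof. by case: n => [|n] [/(within_openP _ oO) cf _]; apply: cf. Qed.

Lemma Ck_onS n f : Ck_on n.+1 O f -> Ck_on n O f.
Proof.
elim: n f => [|n IH] f; first by case.
by move=> [cf H]; split=> // k; have [dk Ck] := H k; split=> //; apply: IH.
Qed.

Lemma Ck_on_congr n f g : (forall y, O y -> f y = g y) ->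
  Ck_on n O f -> Ck_on n O g.
Proof.
elim: n f g => [|n IH] f g fg [cf H].
  split=> //; apply/(within_openP _ oO) => x Ox.
  by apply: (continuous_congr fg) => //; move/(within_openP _ oO): cf; apply.
split.
  apply/(within_openP _ oO) => x Ox.
  by apply: (continuous_congr fg) => //; move/(within_openP _ oO): cf; apply.
move=> k; have [dk Ck] := H k; split.
  by move=> x Ox; apply: (derivable_congr fg) => //; apply: dk.
by apply: IH Ck => y Oy; apply: partial_congr.
Qed.

(** The working criterion for regularity: explicit derivative formulas are required on O only, and
    [Ck_on_congr] transfers their regularity to the actual partial derivatives. *)
Lemma Ck_on_is_derive n f (df : option 'I_3 -> spacetime R -> R) :
  (forall k x, O x -> is_derive x (coord_dir R k) f (df k x)) ->
  (forall x, O x -> {for x, continuous f}) ->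
  (forall k, Ck_on n O (df k)) -> Ck_on n.+1 O f.
Proof.
move=> fd fc Cdf; split; first exact/(within_openP _ oO).
move=> k; split=> [x Ox|]; first by case: (fd k x Ox).
apply: Ck_on_congr (Cdf k) => y Oy; by case: (fd k y Oy).
Qed.

Lemma Ck_on_derivable n f k x : Ck_on n.+1 O f -> O x ->
  is_derive x (coord_dir R k) f (partial k f x).
Proof. by move=> [_ /(_ k)[fd _]] Ox; apply/derivableP/fd. Qed.

Lemma Ck_on_partial n f k : Ck_on n.+1 O f -> Ck_on n O (partial k f).
Proof. by move=> [_ /(_ k)[]]. Qed.

Lemma Ck_on_cst n (c : R) : Ck_on n O (fun=> c).
Proof.
elim: n c => [|n IH] c.
  by split=> //; apply/(within_openP _ oO) => x _; exact: cst_continuous.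
apply: (@Ck_on_is_derive n _ (fun _ _ => 0)) => //.
by move=> x _; exact: cst_continuous.
Qed.

Lemma Ck_onD n f g : Ck_on n O f -> Ck_on n O g ->
  Ck_on n O (fun x => f x + g x).
Proof.
elim: n f g => [|n IH] f g Cf Cg.
  split=> //; apply/(within_openP _ oO) => x Ox.
  exact: continuousD (Ck_on_continuous Cf Ox) (Ck_on_continuous Cg Ox).
apply: (@Ck_on_is_derive n _ (fun k x => partial k f x + partial k g x)).
- move=> k x Ox; apply: (is_deriveD (Ck_on_derivable k Cf Ox) (Ck_on_derivable k Cg Ox)).
- move=> x Ox.
  exact: continuousD (Ck_on_continuous Cf Ox) (Ck_on_continuous Cg Ox).
- by move=> k; apply: IH; apply: Ck_on_partial.
Qed.

Lemma Ck_onM n f g : Ck_on n O f -> Ck_on n O g ->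
  Ck_on n O (fun x => f x * g x).
Proof.
elim: n f g => [|n IH] f g Cf Cg.
  split=> //; apply/(within_openP _ oO) => x Ox.
  exact: continuousM (Ck_on_continuous Cf Ox) (Ck_on_continuous Cg Ox).
apply: (@Ck_on_is_derive n _
  (fun k x => f x * partial k g x + g x * partial k f x)).
- move=> k x Ox; apply: (is_deriveM (Ck_on_derivable k Cf Ox) (Ck_on_derivable k Cg Ox)).
- move=> x Ox.
  exact: continuousM (Ck_on_continuous Cf Ox) (Ck_on_continuous Cg Ox).
- move=> k; apply: Ck_onD; apply: IH; (try exact: Ck_onS); exact: Ck_on_partial.
Qed.

Lemma smooth_on_cst (c : R) : smooth_on O (fun=> c).
Proof. by move=> n; apply: Ck_on_cst. Qed.

Lemma smooth_onD f g : smooth_on O f -> smooth_on O g ->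
  smooth_on O (fun x => f x + g x).
Proof. by move=> Cf Cg n; apply: Ck_onD. Qed.

Lemma smooth_onM f g : smooth_on O f -> smooth_on O g ->
  smooth_on O (fun x => f x * g x).
Proof. by move=> Cf Cg n; apply: Ck_onM. Qed.

Lemma smooth_onN f : smooth_on O f -> smooth_on O (fun x => - f x).
Proof.
move=> Cf n; apply: (@Ck_on_congr n (fun x => -1 * f x)).
  by move=> y _; rewrite mulN1r.
exact: Ck_onM (Ck_on_cst n _) (Cf n).
Qed.

Lemma smooth_on_partial f k : smooth_on O f -> smooth_on O (partial k f).
Proof. by move=> Cf n; apply: Ck_on_partial. Qed.

Lemma smooth_on_is_derive f k x : smooth_on O f -> O x ->
  is_derive x (coord_dir R k) f (partial k f x).
Proof. by move=> Cf Ox; apply: Ck_on_derivable (Cf 1%N) _. Qed.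

Lemma smooth_on_continuous f x : smooth_on O f -> O x ->
  {for x, continuous f}.
Proof. by move=> Cf; apply: Ck_on_continuous (Cf 0%N). Qed.

Lemma is_derive_coord (i : 'I_3) (v x : spacetime R) :
  is_derive x v (fun y : spacetime R => y.1 0 i) (v.1 0 i).
Proof.
apply/is_derive_line; have -> : (fun h : R => (h *: v + x).1 0 i) =
    (fun h : R => v.1 0 i * h + x.1 0 i).
  by apply/funext => h /=; rewrite !mxE mulrC.
exact: is_derive_affine.
Qed.

Lemma is_derive_time (v x : spacetime R) :
  is_derive x v (fun y : spacetime R => y.2) v.2.
Proof.
apply/is_derive_line; have -> : (fun h : R => (h *: v + x).2) =
    (fun h : R => v.2 * h + x.2).
  by apply/funext => h /=; rewrite mulrC.
exact: is_derive_affine.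
Qed.

Lemma continuous_coord i : continuous (fun y : spacetime R => y.1 0 i).
Proof.
move=> x; apply: (@continuous_comp _ _ _ fst (fun p : heis R => p 0 i)).
  exact: cvg_fst.
exact: coord_continuous.
Qed.

Lemma continuous_time : continuous (fun y : spacetime R => y.2).
Proof. move=> x; exact: cvg_snd. Qed.

Lemma smooth_on_coord i : smooth_on O (fun y => y.1 0 i).
Proof.
case=> [|n].
  split=> //; apply/(within_openP _ oO) => x _; exact: continuous_coord.
apply: (@Ck_on_is_derive n _ (fun k _ => (coord_dir R k).1 0 i)).
- move=> k x _; exact: is_derive_coord.
- move=> x _; exact: continuous_coord.
- move=> k; exact: Ck_on_cst.
Qed.

Lemma smooth_on_time : smooth_on O (fun y => y.2).
Proof.
case=> [|n].
  split=> //; apply/(within_openP _ oO) => x _; exact: continuous_time.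
apply: (@Ck_on_is_derive n _ (fun k _ => (coord_dir R k).2)).
- move=> k x _; exact: is_derive_time.
- move=> x _; exact: continuous_time.
- move=> k; exact: Ck_on_cst.
Qed.

Lemma smooth_onV f : (forall x, O x -> f x != 0) -> smooth_on O f ->
  smooth_on O (fun x => (f x)^-1).
Proof.
move=> f0 Cf; elim=> [|n IH].
  split=> //; apply/(within_openP _ oO) => x Ox.
  exact: (continuousV (f0 x Ox) (smooth_on_continuous Cf Ox)).
(* The derivative of 1/f is expressed through 1/f itself, to which the induction hypothesis applies;
   f is smooth of every order and stays fixed. *)
apply: (@Ck_on_is_derive n _
  (fun k x => ((f x)^-1 * (f x)^-1) * (-1 * partial k f x))).
- move=> k x Ox; have fd := smooth_on_is_derive k Cf Ox.
  apply: DeriveDef; first by apply: derivableV; [apply: f0|case: fd].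
  rewrite deriveV; [|exact: f0|by case: fd].
  by rewrite /GRing.scale /= expr2 invfM mulN1r mulrN mulNr.
- move=> x Ox; exact: (continuousV (f0 x Ox) (smooth_on_continuous Cf Ox)).
- move=> k; apply: Ck_onM; first exact: Ck_onM.
  apply: Ck_onM; [exact: Ck_on_cst|exact: Ck_on_partial].
Qed.

(* A smooth function of one variable is given with all its derivatives. *)
Definition jet (G : nat -> R -> R) :=
  forall i (s : R), is_derive s (1 : R) (G i) (G i.+1 s).

Lemma jet_shift G : jet G -> jet (fun i => G i.+1).
Proof. by move=> HG i s; apply: HG. Qed.

Lemma jet_continuous G i : jet G -> continuous (G i).
Proof.
move=> HG s; apply: differentiable_continuous; apply/derivable1_diffP.
by case: (HG i s).
Qed.

(** The induction runs over all jets at once: the derivative has the factor [G 1 \o f], whose outer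
    function is the head of the shifted jet. *)
Lemma smooth_on_comp G f : jet G -> smooth_on O f ->
  smooth_on O (G 0%N \o f).
Proof.
move=> HG Cf n; elim: n G HG => [|n IH] G HG.
  split=> //; apply/(within_openP _ oO) => x Ox.
  apply: (@continuous_comp _ _ _ f (G 0%N) x).
    exact: smooth_on_continuous Cf Ox.
  exact: jet_continuous.
apply: (@Ck_on_is_derive n _ (fun k x => G 1%N (f x) * partial k f x)).
- move=> k x Ox; apply: is_derive_comp1; first exact: smooth_on_is_derive.
  exact: HG.
- move=> x Ox.
  apply: (@continuous_comp _ _ _ f (G 0%N) x).
    exact: smooth_on_continuous Cf Ox.
  exact: jet_continuous.
- move=> k; apply: Ck_onM; last exact: Ck_on_partial.
  exact: (IH _ (jet_shift HG)).
Qed.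

Lemma partial_comp G f k x : jet G -> smooth_on O f -> O x ->
  partial k (G 0%N \o f) x = G 1%N (f x) * partial k f x.
Proof.
move=> HG Cf Ox; have Hf := smooth_on_is_derive k Cf Ox.
by case: (is_derive_comp1 Hf (HG 0%N (f x))).
Qed.

End Ck_closure.

(** * Smooth nondecreasing functions above a prescribed sequence *)

Section growth.
Context (R : realType).

Lemma is_derive_quad_bound (f : R -> R) (C : R) : f 0 = 0 ->
  (\forall h \near 0, `|f h| <= C * h ^+ 2) -> is_derive (0 : R) (1 : R) f 0.
Proof.
move=> f0 fC.
have C0 : 0 <= `|C| + 1 by rewrite addr_ge0.
have H : (fun h => h^-1 *: ((f \o shift 0) (h *: (1 : R)) - f 0)) @ 0^' --> (0 : R).
  apply/cvgrPdist_le => e e0.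
  have [d /= d0 fd] : \forall h \near (0 : R),
      `|f h| <= C * h ^+ 2 /\ `|h| * (`|C| + 1) <= e.
    apply: filterI => //; exists (e / (`|C| + 1)) => /=.
      by rewrite divr_gt0 // ltr_wpDl.
    move=> h /=; rewrite sub0r normrN ltr_pdivlMr ?ltr_wpDl // => /ltW; exact.
  exists d => //= h hd h0; have [{}fd he] := fd h hd.
  rewrite sub0r normrN addr0 [h *: 1]mulr1 f0 subr0 [_ *: _]/(_ * _).
  rewrite normrM normfV mulrC ler_pdivrMr ?normr_gt0 //.
  apply: le_trans fd _; rewrite -normr_id -real_normK ?num_real // expr2 mulrA.
  rewrite normr_id ler_wpM2r //; apply: le_trans he.
  by rewrite mulrC ler_wpM2l // (le_trans (ler_norm _)) // lerDl.
apply: DeriveDef; first by apply/cvg_ex; exists 0.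
exact: cvg_lim H.
Qed.

(** The functions p(1/x) e^(-1/x), extended by 0 to x <= 0, are stable under differentiation, so one
    first-order argument for all p yields smoothness; p = 1 is the classical flat function. *)
Definition bump (p : {poly R}) (x : R) : R :=
  if 0 < x then p.[x^-1] * expR (- x^-1) else 0.

(** For n > 0, e^y = (e^(y/n))^n >= (y/n)^n. *)
Lemma exprn_le_expR (y : R) n : 0 <= y -> y ^+ n <= n%:R ^+ n * expR y.
Proof.
case: n => [|n] y0; first by rewrite !expr0 mul1r -expR0 ler_expR.
have -> : expR y = expR (y / n.+1%:R) ^+ n.+1.
  by rewrite -expRM_natl mulrC divfK // pnatr_eq0.
rewrite -exprMn; apply: lerXn2r; rewrite ?nnegrE ?mulr_ge0 ?expR_ge0 //.
rewrite mulrC -ler_pdivrMr ?ltr0n //.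
by apply: le_trans (expR_ge1Dx _); rewrite lerDr.
Qed.

Lemma horner_bound (p : {poly R}) :
  exists2 C, 0 <= C & forall y, 1 <= y -> `|p.[y]| <= C * y ^+ size p.
Proof.
exists (\sum_(i < size p) `|p`_i|); first exact: sumr_ge0.
move=> y y1; rewrite horner_coef mulr_suml; apply: le_trans (ler_norm_sum _ _ _) _.
apply: ler_sum => i _; rewrite normrM ler_wpM2l //.
rewrite normrX ger0_norm ?(le_trans ler01) //.
by apply: ler_weXn2l => //; apply: ltnW.
Qed.

Lemma bump_quad_bound p :
  exists C : R, \forall h \near (0 : R), `|bump p h| <= C * h ^+ 2.
Proof.
have [C C0 pC] := horner_bound p.
(* With y = 1/h, [size p] powers of y bound p(y) and the two extra ones produce the factor h^2. *)
set m := (size p + 2)%N.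
exists (C * m%:R ^+ m).
exists 1 => //= h; rewrite /= sub0r normrN /bump => h1.
have [h0|_] := ltP 0 h; last first.
  rewrite normr0; apply: mulr_ge0; last exact: sqr_ge0.
  by apply: mulr_ge0 => //; rewrite exprn_ge0 // ler0n.
rewrite gtr0_norm // in h1.
have hV : 1 <= h^-1 by rewrite invf_ge1 // ltW.
have hV0 : 0 < h^-1 by rewrite invr_gt0.
rewrite normrM (ger0_norm (expR_ge0 _)).
apply: le_trans (ler_wpM2r (expR_ge0 _) (pC _ hV)) _.
rewrite -!mulrA ler_wpM2l // expRN ler_pdivrMr ?expR_gt0 //.
have := exprn_le_expR m (ltW hV0).
rewrite /m exprD -(ler_pM2r (_ : 0 < h ^+ 2)) ?exprn_gt0 //.
rewrite -mulrA -exprMn mulVf ?gt_eqF // expr1n mulr1.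
by rewrite mulrAC.
Qed.

(** Differentiating p(1/x) e^(-1/x) gives x^(-2) (p - p')(1/x) e^(-1/x), again of the same form. *)
Definition dbump (p : {poly R}) : {poly R} := 'X^2 * (p - p^`()).

Lemma is_derive_bump p x : is_derive (x : R) (1 : R) (bump p) (bump (dbump p) x).
Proof.
have [x0|x0|->] := ltgtP x 0.
- have -> : bump (dbump p) x = 0 by rewrite /bump ltNge ltW.
  apply: (@near_eq_is_derive _ _ _ (cst 0)).
  near=> y; rewrite /bump ltNge ltW //=; near: y; exact: lt_nbhsl.
- have -> : bump (dbump p) x = (dbump p).[x^-1] * expR (- x^-1).
    by rewrite /bump x0.
  apply: (@near_eq_is_derive _ _ _
      ((fun z => p.[z] * expR (- z)) \o (fun y : R => y^-1))).
    near=> y; rewrite /bump ifT //; near: y; exact: lt_nbhsr.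
  have H : is_derive (x : R) (1 : R) (fun y : R => y^-1) (- x ^- 2).
    apply: DeriveDef; first by apply: derivableV; rewrite ?gt_eqF.
    by rewrite deriveV ?gt_eqF // derive_id [_ *: _]mulr1.
  have H2 : is_derive (x^-1 : R) (1 : R) (fun z => p.[z] * expR (- z))
      (p.[x^-1] * (- expR (- x^-1)) + expR (- x^-1) * p^`().[x^-1]).
    apply: (@is_deriveM _ _ (horner p) (fun z => expR (- z))).
    by have := is_derive_comp1 (is_deriveNid (x^-1 : R) 1) (is_derive_expR _);
      rewrite mulrN1.
  have H3 := is_derive_comp1 H H2.
  apply: (is_derive_eq H3).
  rewrite /dbump hornerM hornerXn hornerD hornerN exprVn; ring.
- have -> : bump (dbump p) 0 = 0 by rewrite /bump ltxx.
  have [C HC] := bump_quad_bound p.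
  by apply: is_derive_quad_bound HC; rewrite /bump ltxx.
Unshelve. all: by end_near. Qed.

Definition jbump i := bump (iter i dbump 1).

Lemma jet_jbump : jet jbump.
Proof. by move=> i s; apply: is_derive_bump. Qed.

Lemma jbump_le0 i x : x <= 0 -> jbump i x = 0.
Proof. by move=> x0; rewrite /jbump /bump ltNge x0. Qed.

Lemma jbump0_ge0 x : 0 <= jbump 0 x.
Proof.
by rewrite /jbump /bump /=; case: ifP => // _; rewrite hornerC mul1r expR_ge0.
Qed.

Lemma jbump1_ge0 x : 0 <= jbump 1 x.
Proof.
rewrite /jbump /bump /dbump /=; case: ifP => // _.
rewrite hornerM hornerXn derivC subr0 hornerC mulr1.
by rewrite mulr_ge0 ?expR_ge0 ?sqr_ge0.
Qed.

Lemma jbump0_ge1 x : 1 <= x -> expR (-1) <= jbump 0 x.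
Proof.
move=> x1; have x0 : 0 < x by apply: lt_le_trans x1.
by rewrite /jbump /bump /= x0 hornerC mul1r ler_expR lerN2 invf_le1.
Qed.

(** The sum over all n of a_n [jbump i] (s - n): terms with n >= s vanish, so it is locally finite.
    The cut-off varies with s; [growthE] replaces it by any fixed N on {s < N}, where the sum can be
    differentiated term by term. *)
Definition growth (a : nat -> R) i (s : R) : R :=
  \sum_(0 <= n < (Num.truncn `|s|).+1) a n * jbump i (s - n%:R).

Lemma growthE a i s N : s < N%:R ->
  growth a i s = \sum_(0 <= n < N) a n * jbump i (s - n%:R).
Proof.
have E m M : s < m%:R -> (m <= M)%N ->
    \sum_(0 <= n < M) a n * jbump i (s - n%:R) =
    \sum_(0 <= n < m) a n * jbump i (s - n%:R).
  move=> sm mM; rewrite (big_cat_nat (leq0n m) mM) /= [X in _ + X]big_nat_cond.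
  rewrite [X in _ + X]big1 ?addr0 // => n /andP[/andP[mn _] _].
  rewrite jbump_le0 ?mulr0 // subr_le0 (le_trans (ltW sm)) //.
  by rewrite ler_nat.
move=> sN; rewrite /growth.
have sT : s < (Num.truncn `|s|).+1%:R.
  by apply: le_lt_trans (ler_norm _) _; exact: truncnS_gt.
by case: (leqP N (Num.truncn `|s|).+1) => [h|/ltnW h]; rewrite (E _ _ _ h).
Qed.

Lemma jet_growth a : jet (growth a).
Proof.
move=> i s.
have [N sN] : exists N : nat, s < N%:R.
  exists (Num.truncn `|s|).+1.
  by apply: le_lt_trans (ler_norm _) _; exact: truncnS_gt.
rewrite (growthE _ _ sN).
suff H : is_derive s (1 : R)
    (fun s => \sum_(0 <= n < N) a n * jbump i (s - n%:R))
    (\sum_(0 <= n < N) a n * jbump i.+1 (s - n%:R)).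
  apply: near_eq_is_derive H.
  near=> y; rewrite (@growthE _ _ _ N) //; near: y; exact: lt_nbhsl.
elim: N {sN} => [|N IH].
  rewrite big_geq //; under eq_fun do rewrite big_geq //.
  exact: is_derive_cst.
rewrite big_nat_recr //=; under eq_fun do rewrite big_nat_recr //=.
apply: is_deriveD.
have H : is_derive s (1 : R) (fun s : R => s - N%:R) 1.
  by have := is_derive_affine 1 (- N%:R) s; under eq_fun do rewrite mul1r.
have := is_derive_comp1 H (jet_jbump i _); rewrite mulr1 => H1.
exact: (is_deriveZ (a N) H1).
Unshelve. all: by end_near. Qed.

Lemma growth_ge0 a i s : (i <= 1)%N -> (forall n, 0 <= a n) -> 0 <= growth a i s.
Proof.
move=> i1 a0; apply: sumr_ge0 => n _; apply: mulr_ge0 => //.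
by case: i i1 => [|[|]] // _; [exact: jbump0_ge0|exact: jbump1_ge0].
Qed.

Lemma growth_le0 a i s : s <= 0 -> growth a i s = 0.
Proof.
by move=> s0; rewrite (@growthE a i s 1) ?big_nat1 ?jbump_le0 ?mulr0 ?subr0 //;
  apply: le_lt_trans s0 _.
Qed.

Lemma exists_growth (M : nat -> R) :
  exists G, [/\ jet G, forall s, 0 <= G 0%N s, forall s, 0 <= G 1%N s,
    G 0%N 0 = 0 & forall s n, n.+1%:R <= s -> M n <= G 0%N s].
Proof.
have e0 : 0 < expR (-1 : R) by exact: expR_gt0.
(* For s >= n + 1 the n-th term alone reaches M n, because the flat function is at least e^(-1) on
   [1, oo). *)
pose a n := `|M n| / expR (-1).
have a0 n : 0 <= a n by rewrite divr_ge0 // ltW.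
exists (growth a); split; first exact: jet_growth.
- by move=> s; apply: growth_ge0.
- by move=> s; apply: growth_ge0.
- exact: growth_le0.
move=> s n ns.
apply: (@le_trans _ _ (a n * jbump 0 (s - n%:R))).
  apply: (@le_trans _ _ (a n * expR (-1))).
    by rewrite /a divfK ?gt_eqF // ler_norm.
  by apply: ler_wpM2l => //; apply: jbump0_ge1; rewrite lerBrDr -natr1 addrC in ns *.
have sT : s < (Num.truncn `|s|).+1%:R.
  by apply: le_lt_trans (ler_norm _) _; exact: truncnS_gt.
rewrite (growthE _ _ sT).
have nN : (n < (Num.truncn `|s|).+1)%N.
  by rewrite -(ltr_nat R); apply: le_lt_trans sT; apply: le_trans ns; rewrite ler_nat.
rewrite (big_cat_nat (leq0n n) (ltnW nN)) /= (big_ltn nN).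
rewrite addrCA lerDl addr_ge0 // sumr_ge0 // => k _;
  by rewrite mulr_ge0 // jbump0_ge0.
Qed.

End growth.

(** * Horizontal derivatives and their chain rule *)

Section horizontal.
Context (R : realType) (O : set (spacetime R)).
Hypothesis oO : open O.
Implicit Types f g : spacetime R -> R.

Definition hcoef (i : 'I_2) (x : spacetime R) : R :=
  if i == 0 then - (x.1 0 1 / 2) else x.1 0 0 / 2.

Lemma horizXE i f x : horizX i f x =
  partial (Some (widen_ord (leqnSn 2) i)) f x
  + hcoef i x * partial (Some 2) f x.
Proof.
rewrite /horizX /hcoef; case: ifP => [/eqP->|].
  by rewrite /X1 mulNr; congr (partial (Some _) _ _ - _); apply: val_inj.
by case: i => -[|[|]] //= hi _; rewrite /X2;
  congr (partial (Some _) _ _ + _); apply: val_inj.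
Qed.

Lemma smooth_on_hcoef i : smooth_on O (hcoef i).
Proof.
have H (j : 'I_3) : smooth_on O (fun x => x.1 0 j / 2).
  apply: (smooth_onM oO); [exact: smooth_on_coord|exact: smooth_on_cst].
by rewrite /hcoef; case: (i == 0) => //; apply: (smooth_onN oO).
Qed.

Lemma smooth_on_horizX i f : smooth_on O f -> smooth_on O (horizX i f).
Proof.
move=> Cf; have -> : horizX i f = (fun x =>
    partial (Some (widen_ord (leqnSn 2) i)) f x
    + hcoef i x * partial (Some 2) f x).
  by apply/funext => x; exact: horizXE.
apply: (smooth_onD oO); first exact: smooth_on_partial.
by apply: (smooth_onM oO); [exact: smooth_on_hcoef|exact: smooth_on_partial].
Qed.

Lemma horizX_congr i f g x : (forall y, O y -> f y = g y) -> O x ->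
  horizX i f x = horizX i g x.
Proof. by move=> fg Ox; rewrite !horizXE !(partial_congr oO _ fg). Qed.

Lemma horizX_comp i G f x : jet G -> smooth_on O f -> O x ->
  horizX i (G 0%N \o f) x = G 1%N (f x) * horizX i f x.
Proof.
move=> HG Cf Ox; rewrite !horizXE !(partial_comp _ HG Cf Ox) mulrDr.
by congr (_ + _); rewrite mulrCA.
Qed.

Lemma partialM k f g x : smooth_on O f -> smooth_on O g -> O x ->
  partial k (fun y => f y * g y) x = f x * partial k g x + g x * partial k f x.
Proof.
move=> Cf Cg Ox.
by case: (is_deriveM (smooth_on_is_derive k Cf Ox)
  (smooth_on_is_derive k Cg Ox)).
Qed.

Lemma horizXM i f g x : smooth_on O f -> smooth_on O g -> O x ->
  horizX i (fun y => f y * g y) x = f x * horizX i g x + g x * horizX i f x.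
Proof. by move=> Cf Cg Ox; rewrite !horizXE !partialM //; ring. Qed.

Lemma horizX2_comp i j G f x : jet G -> smooth_on O f -> O x ->
  horizX i (horizX j (G 0%N \o f)) x =
  G 1%N (f x) * horizX i (horizX j f) x
  + G 2%N (f x) * (horizX i f x * horizX j f x).
Proof.
move=> HG Cf Ox.
have HG1 := jet_shift HG.
rewrite (@horizX_congr _ _ (fun y => (G 1%N \o f) y * horizX j f y)) //; last first.
  by move=> y Oy; rewrite horizX_comp.
rewrite horizXM //; last 2 first.
- exact: (smooth_on_comp oO HG1 Cf).
- exact: smooth_on_horizX.
by rewrite (horizX_comp _ HG1 Cf Ox) /=; ring.
Qed.

Lemma gradH_comp G f x : jet G -> smooth_on O f -> O x ->
  gradH (G 0%N \o f) x = G 1%N (f x) *: gradH f x.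
Proof.
by move=> HG Cf Ox; apply/rowP => i; rewrite !mxE (horizX_comp _ HG Cf Ox).
Qed.

Lemma hessH_comp G f x : jet G -> smooth_on O f -> O x ->
  hessH (G 0%N \o f) x =
  G 1%N (f x) *: hessH f x + G 2%N (f x) *: ((gradH f x)^T *m gradH f x).
Proof.
move=> HG Cf Ox; apply/matrixP => i j.
rewrite !mxE big_ord1 !mxE !(horizX2_comp _ _ HG Cf Ox).
by field.
Qed.

End horizontal.

(** * Algebra of the mean curvature operator *)

Section mcf_op.
Context (R : realType).
Implicit Types (eta : 'rV[R]_2) (Y : 'M[R]_2).

Lemma mcf_opE eta Y : mcf_op eta Y =
  (eta 0 0 ^+ 2 * Y 0 0 + eta 0 0 * eta 0 1 * (Y 0 1 + Y 1 0)
    + eta 0 1 ^+ 2 * Y 1 1) / (eta 0 0 ^+ 2 + eta 0 1 ^+ 2) - (Y 0 0 + Y 1 1).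
Proof.
have E2 (F : 'I_2 -> R) : \sum_i F i = F 0 + F 1.
  by rewrite big_ord_recl big_ord1; congr (F _ + F _); apply: val_inj.
rewrite /mcf_op /mxtrace !(E2, mxE) !big_ord1 !mxE /=.
by ring.
Qed.

Lemma rV2_neq0 eta : (eta != 0) = (0 < eta 0 0 ^+ 2 + eta 0 1 ^+ 2).
Proof.
rewrite lt0r addr_ge0 ?sqr_ge0 // andbT; congr negb.
rewrite paddr_eq0 ?sqr_ge0 // !sqrf_eq0; apply/eqP/andP => [->|[/eqP a /eqP b]].
  by rewrite !mxE.
apply/rowP => -[[|[|]] // hi]; rewrite [RHS]mxE.
  by rewrite -[RHS]a; congr (eta _ _); apply: val_inj.
by rewrite -[RHS]b; congr (eta _ _); apply: val_inj.
Qed.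

(** This is what makes the equation geometric: the projection orthogonal to eta is unchanged by
    scaling and annihilates eta^T eta, so the second derivative of the outer function in
    [hessH_comp] disappears. *)
Lemma mcf_op_comp eta Y (c d : R) : c != 0 -> eta != 0 ->
  mcf_op (c *: eta) (c *: Y + d *: (eta^T *m eta)) = c * mcf_op eta Y.
Proof.
move=> c0; rewrite rV2_neq0 => /lt0r_neq0 e0.
rewrite !mcf_opE !mxE !big_ord1 !mxE.
field; rewrite e0 /=.
by rewrite !exprMn -mulrDr mulf_neq0 // expf_neq0.
Qed.

(** Oddness exchanges subsolutions and supersolutions under u -> -u. *)
Lemma mcf_opN eta Y : mcf_op (- eta) (- Y) = - mcf_op eta Y.
Proof.
rewrite !mcf_opE !mxE !sqrrN mulrNN -!opprD; ring.
Qed.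

End mcf_op.

(** * Barrier argument with strict supersolutions *)

Section barrier.
Context (R : realType).
Implicit Types (O : set (spacetime R)) (u phi Psi : spacetime R -> R).

(** The test condition alone, for real-valued functions, so that u, -u and [theta \o u] are handled
    alike; supersolutions enter through -u. *)
Definition visc_sub O u := forall phi x, smooth_on O phi -> O x ->
  (forall y, O y -> u y - phi y <= u x - phi x) ->
  (gradH phi x != 0 ->
     partial None phi x + mcf_op (gradH phi x) (hessH phi x) <= 0) /\
  (gradH phi x = 0 -> hessH phi x = 0 -> partial None phi x <= 0).

(** At a zero of the gradient the Hessian has to vanish as well: otherwise the subsolution test is
    silent and no contradiction could arise. *)
Definition strict_super Psi x :=
  (gradH Psi x != 0 /\
     0 < partial None Psi x + mcf_op (gradH Psi x) (hessH Psi x)) \/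
  [/\ gradH Psi x = 0, hessH Psi x = 0 & 0 < partial None Psi x].

Lemma visc_sub_no_strict O u Psi T x : open O -> visc_sub O u ->
  smooth_on O Psi -> jet T -> 0 < T 1%N (Psi x) -> O x ->
  (forall y, O y -> u y - T 0%N (Psi y) <= u x - T 0%N (Psi x)) ->
  ~ strict_super Psi x.
Proof.
move=> oO hu Cf HT T1 Ox umax.
have [H1 H2] := hu _ x (smooth_on_comp oO HT Cf) Ox umax.
have T1n : T 1%N (Psi x) != 0 by rewrite gt_eqF.
move: H1 H2; rewrite (gradH_comp HT Cf Ox) (hessH_comp oO HT Cf Ox).
rewrite (partial_comp _ HT Cf Ox) => H1 H2 [[g0 S0]|[g0 h0 S0]].
  move: H1; rewrite scaler_eq0 negb_or T1n g0 => /(_ isT).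
  rewrite mcf_op_comp // -mulrDr pmulr_rle0 //.
  by rewrite leNgt S0.
move: H2; rewrite g0 h0 !scaler0 mulmx0 scaler0 addr0 => /(_ erefl erefl).
by rewrite pmulr_rle0 // leNgt S0.
Qed.

(** The jet of (e^(l^2 s) - 1)/l. For l > 0 this function lies above both l s and -1/l, the two
    bounds that the barrier uses. *)
Definition expjet (l : R) i (s : R) : R :=
  if i is j.+1 then l * (l ^+ 2) ^+ j * expR (l ^+ 2 * s)
  else (expR (l ^+ 2 * s) - 1) / l.

Lemma jet_expjet l : l != 0 -> jet (expjet l).
Proof.
move=> l0.
have H s : is_derive s (1 : R) (fun s => expR (l ^+ 2 * s))
    (expR (l ^+ 2 * s) * l ^+ 2).
  have H1 : is_derive s (1 : R) (fun s => l ^+ 2 * s) (l ^+ 2).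
    by have := is_derive_affine (l ^+ 2) 0 s; under eq_fun do rewrite addr0.
  exact: (is_derive_comp1 H1 (is_derive_expR _)).
case=> [|j] s.
  have H1 := is_deriveZ l^-1 (is_deriveB (H s) (is_derive_cst (1 : R) s 1)).
  have -> : expjet l 0 =
      (l^-1 *: ((fun s => expR (l ^+ 2 * s)) - cst (1 : R)) : R -> R).
    by apply/funext => x; rewrite /= /expjet mulrC.
  apply: (is_derive_eq H1).
  change (l^-1 * (expR (l ^+ 2 * s) * l ^+ 2 - 0) =
    l * (l ^+ 2) ^+ 0 * expR (l ^+ 2 * s)).
  by field.
have H1 := is_deriveZ (l * (l ^+ 2) ^+ j) (H s).
apply: (is_derive_eq H1).
change (l * (l ^+ 2) ^+ j * (expR (l ^+ 2 * s) * l ^+ 2) =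
  l * (l ^+ 2) ^+ j.+1 * expR (l ^+ 2 * s)).
by move: (l ^+ 2) => a; rewrite exprS; ring.
Qed.

Lemma compact_upper_bound (K : set (spacetime R)) (f : spacetime R -> R) :
  compact K -> (forall x, K x -> {for x, continuous f}) ->
  exists B, forall x, K x -> f x <= B.
Proof.
move=> cK cf; have [->|K0] := eqVneq K set0; first by exists 0.
have [|x _ xmax] := compact_EVT_max (proj1 (set0P _) K0) cK (f := f).
  by apply: continuous_in_subspaceT => x; rewrite inE; exact: cf.
by exists (f x) => y Ky; apply: xmax; rewrite inE.
Qed.

Lemma compact_pos_lower_bound (K : set (spacetime R)) (f : spacetime R -> R) :
  compact K -> (forall x, K x -> {for x, continuous f}) ->
  (forall x, K x -> 0 < f x) ->
  exists2 d, 0 < d & forall x, K x -> d <= f x.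
Proof.
move=> cK cf f0; have [->|K0] := eqVneq K set0; first by exists 1.
have [|x xK xmin] := compact_EVT_min (proj1 (set0P _) K0) cK (f := f).
  by apply: continuous_in_subspaceT => x; rewrite inE; exact: cf.
exists (f x); first by apply: f0; rewrite inE in xK.
by move=> y Ky; apply: xmin; rewrite inE.
Qed.

(* u is compared with T(Psi), T(s) = (e^(l^2 s) - 1)/l + g(s): as l grows, the
   first term tends to 0 for s < 0 and to infinity for s > 0, which confines the
   maximum of u - T(Psi) to any neighbourhood of {u >= u x0, Psi <= 0}; the
   second term dominates u for large Psi. *)
Lemma barrier O u Psi x0 : open O -> (forall x, O x -> {for x, continuous u}) ->
  visc_sub O u -> smooth_on O Psi ->
  (forall s, exists K, [/\ compact K, K `<=` O &
     forall x, O x -> Psi x <= s -> K x]) ->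
  O x0 -> Psi x0 = 0 ->
  (forall x, O x -> Psi x <= 0 -> u x0 <= u x ->
     \forall y \near x, strict_super Psi y) -> False.
Proof.
move=> oO cu hu CP Psi_coercive Ox0 Psi0 strict.
set c := u x0.
have ubound s : exists B, forall x, O x -> Psi x <= s -> u x - c <= B.
  have [K [cK KO PK]] := Psi_coercive s.
  have [|B uB] := @compact_upper_bound K (fun x => u x - c) cK.
    move=> x /KO Ox; apply: (continuousB (cu x Ox)); exact: cst_continuous.
  by exists B => x Ox /PK Kx; apply: uB; apply: Kx.
(* [G] exceeds M n from n + 1 on, so M n has to serve for n + 1 <= Psi < n + 2; hence the level n +
   2. *)
have [M uM] := choice (fun n : nat => ubound n.+2%:R).
have [G [jG G0 G1 G00 GM]] := exists_growth M.
have uG x : O x -> 1 <= Psi x -> u x - c <= G 0%N (Psi x).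
  move=> Ox P1; have P0 : 0 <= Psi x by apply: le_trans P1.
  have := truncn_itv P0; case E : (Num.truncn (Psi x)) => [|n] /andP[n1 n2].
    by move: n2; rewrite ltNge P1.
  by apply: le_trans (GM _ n n1); apply: uM => //; apply: ltW.
have [K [cK KO PK]] := Psi_coercive 1.
pose W := interior [set x | strict_super Psi x].
(* Outside W a point of K has Psi > 0 or u < c, so m is positive there and, by compactness, at least
   some d > 0. *)
pose m x := Num.max (Psi x) (c - u x).
have cK1 : compact (K `&` ~` W).
  apply: compact_closedI => //; apply: open_closedC; exact: open_interior.
have [||d d0 dm] := @compact_pos_lower_bound _ m cK1.
- move=> x [/KO Ox _]; apply: continuous_max.
    exact: smooth_on_continuous CP Ox.
  apply: continuousB; [exact: cst_continuous|exact: cu].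
- move=> x [/KO Ox Wx]; rewrite lt_max subr_gt0.
  case: ltP => //= P0; case: ltP => // uc; case: Wx; exact: strict.
have [B uB] := ubound 1.
(* With l d = B' the two cases of m >= d close: if Psi >= d, then l Psi >= B' > B beats u - c where
   Psi <= 1 (beyond, [G] already does); if u <= c - d, the loss 1/l = d/B' is less than d. *)
pose B' := `|B| + 2%:R.
have B'0 : 0 < B' by rewrite ltr_wpDl.
pose l := B' / d; have l0 : 0 < l by rewrite divr_gt0.
have ld : l * d = B' by rewrite divfK // gt_eqF.
pose T i s := expjet l i s + G i s.
have jT : jet T.
  move=> i s; have je := jet_expjet (lt0r_neq0 l0) i s.
  exact: (is_deriveD je (jG i s)).
have T1 s : 0 < T 1%N s.
  rewrite /T ltr_wpDr //= expr0 mulr1 mulr_gt0 ?expR_gt0 //.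
have E_ge s : l * s <= expjet l 0 s.
  rewrite /= ler_pdivlMr // lerBrDl.
  by apply: le_trans (expR_ge1Dx _); rewrite lerD2l mulrAC -expr2.
have E_gt s : - l^-1 < expjet l 0 s.
  by rewrite /= -[- l^-1]mulN1r ltr_pM2r ?invr_gt0 // ltrBrDl subrr expR_gt0.
have T0 : T 0%N 0 = 0.
  by rewrite /T G00 /= mulr0 expR0 subrr mul0r addr0.
have neg x : (K `&` ~` W) x -> u x - T 0%N (Psi x) < c.
  move=> K1x; have Ox : O x by apply: KO; case: K1x.
  rewrite /T; have := dm x K1x; rewrite /m le_max => /orP[dP|du].
    have Psi1 : Psi x <= 1 \/ 1 < Psi x by case: (leP (Psi x) 1); [left|right].
    rewrite ltrBlDr addrC -ltrBlDr.
    have Kle : u x - c <= B \/ u x - c <= G 0%N (Psi x).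
      by case: Psi1 => [/(uB x Ox)|/ltW/(uG x Ox)]; [left|right].
    have El : B < expjet l 0 (Psi x).
      apply: lt_le_trans (E_ge _); apply: (@lt_le_trans _ _ B').
        by rewrite (le_lt_trans (ler_norm _)) // ltrDl.
      by rewrite -ld ler_pM2l.
    case: Kle => [uB1|uG1].
      by apply: le_lt_trans uB1 _; apply: (lt_le_trans El); rewrite lerDl.
    apply: le_lt_trans uG1 _; rewrite ltrDr; apply: lt_le_trans (E_ge _).
    by rewrite mulr_gt0 // (lt_le_trans d0).
  have lVd : l^-1 < d.
    rewrite -[l^-1]mul1r ltr_pdivrMr // mulrC ld /B'.
    by have := normr_ge0 B; lra.
  have := E_gt (Psi x); have := G0 (Psi x); move: lVd du.
  lra.
have Kx0 : K x0 by apply: PK => //; rewrite Psi0 ler01.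
have [|x xK xmax] := @compact_EVT_max _ _ (fun x => u x - T 0%N (Psi x)) K
    (ex_intro _ x0 Kx0) cK.
  apply: continuous_in_subspaceT => x; rewrite inE => /KO Ox.
  exact: continuousB (cu x Ox)
    (smooth_on_continuous oO (smooth_on_comp oO jT CP) Ox).
rewrite inE in xK; have Ox := KO _ xK.
have xc : c <= u x - T 0%N (Psi x).
  by have := xmax x0; rewrite inE => /(_ Kx0); rewrite Psi0 T0 subr0.
apply: (visc_sub_no_strict (x := x) oO hu CP jT (T1 _) Ox).
  (* The maximum over K is global: outside K one has Psi > 1, where [G] dominates u - c, so u -
     T(Psi) <= c, and c is the value at x0. *)
  move=> y Oy; have [Ky|Ky] := pselect (K y); first by apply: xmax; rewrite inE.
  apply: le_trans xc; have P1 : 1 < Psi y.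
    by rewrite ltNge; apply/negP => P1; apply: Ky; apply: PK.
  rewrite lerBlDr addrC -lerBlDr; apply: le_trans (uG y Oy (ltW P1)) _.
  rewrite /T lerDr; apply: le_trans (E_ge _).
  by rewrite mulr_ge0 // ?ltW // (lt_trans ltr01).
have Wx : W x.
  apply: contrapT => Wx; have := neg x (conj xK Wx).
  by rewrite ltNge xc.
exact: (interior_subset Wx).
Qed.

End barrier.

(** * First- and second-order Taylor estimates in space-time *)

Section increments.
Context (R : realType) (O : set (spacetime R)).
Hypothesis oO : open O.
Implicit Types (f phi u : spacetime R -> R) (x y z v : spacetime R).

Definition coord (k : option 'I_3) (v : spacetime R) : R :=
  if k is Some i then v.1 0 i else v.2.

Definition csum (F : option 'I_3 -> R) : R :=
  F (Some 0) + F (Some 1) + F (Some 2) + F None.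

Lemma ord3P (i : 'I_3) : [\/ i = 0, i = 1 | i = 2].
Proof.
by case: i => -[|[|[|]]] // hi;
  [apply: Or31|apply: Or32|apply: Or33]; apply: val_inj.
Qed.

Lemma eq_csum F G : (forall k, F k = G k) -> csum F = csum G.
Proof. by move=> FG; rewrite /csum !FG. Qed.

Lemma csumD F G : csum (fun k => F k + G k) = csum F + csum G.
Proof.
rewrite /csum; move: (F (Some 0)) (F (Some 1)) (F (Some 2)) (F None).
by move: (G (Some 0)) (G (Some 1)) (G (Some 2)) (G None) => *; ring.
Qed.

Lemma csumZ a F : csum (fun k => a * F k) = a * csum F.
Proof. by rewrite /csum !mulrDr. Qed.

Lemma le_csum F G : (forall k, F k <= G k) -> csum F <= csum G.
Proof. by move=> FG; rewrite /csum !lerD. Qed.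

Lemma ler_csum F k : (forall k, 0 <= F k) -> F k <= csum F.
Proof.
move=> F0; rewrite /csum; move: (F0 (Some 0)) (F0 (Some 1)) (F0 (Some 2)) (F0 None).
case: k => [i|]; last by move: (F _) (F _) (F _) (F _) => *; lra.
by have [->|->|->] := ord3P i; move: (F _) (F _) (F _) (F _) => *; lra.
Qed.

Definition box x (r : R) : set (spacetime R) :=
  [set y | forall k, `|coord k y - coord k x| < r].

Lemma coordD k x y : coord k (x + y) = coord k x + coord k y.
Proof. by case: k => [i|] //=; rewrite mxE. Qed.

Lemma coordB k x y : coord k (x - y) = coord k x - coord k y.
Proof. by case: k => [i|] //=; rewrite !mxE. Qed.

Lemma coordZ k a x : coord k (a *: x) = a * coord k x.
Proof. by case: k => [i|] //=; rewrite mxE. Qed.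

Lemma coord_coord_dir k j : coord k (coord_dir R j) = (k == j)%:R.
Proof.
case: k j => [i|] [j|] //=; rewrite ?mxE ?eqxx //=.
Qed.

Lemma nbhs_box x (A : set (spacetime R)) :
  nbhs x A -> exists2 r : R, 0 < r & box x r `<=` A.
Proof.
move=> /nbhs_ballP[r /= r0 rA]; exists r => // y yb; apply: rA; split.
  by split=> // i j; rewrite ord1 /ball /= distrC; exact: (yb (Some j)).
by rewrite /ball /= distrC; exact: (yb None).
Qed.

Lemma box_nbhs x (r : R) : 0 < r -> nbhs x (box x r).
Proof.
move=> r0; apply: filterS (nbhsx_ballx x r r0) => y [/= [_ yb1] yb2] [i|] /=.
  by rewrite distrC; exact: (yb1 0 i).
by rewrite distrC; exact: yb2.
Qed.

Lemma is_derive_line_at f x v (h df : R) :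
  is_derive (h *: v + x) v f df ->
  is_derive h (1 : R) (fun h : R => f (h *: v + x)) df.
Proof.
move=> /is_derive_line H.
have H1 : is_derive h (1 : R) (fun t : R => t - h) 1.
  by have := is_derive_affine 1 (- h) h; under eq_fun do rewrite mul1r.
rewrite -(subrr h) in H.
have := is_derive_comp1 H1 H; rewrite mulr1.
set F := _ \o _; suff -> : F = (fun t : R => f (t *: v + x)) by [].
by apply/funext => t; rewrite /F /= scalerBl addrA subrK.
Qed.

Lemma mvt_le (g dg : R -> R) (a b C : R) : a <= b ->
  (forall h, a <= h <= b -> is_derive h (1 : R) g (dg h) /\ dg h <= C) ->
  g b - g a <= C * (b - a).
Proof.
move=> ab H.
have D1 h : h \in `]a, b[ -> is_derive h (1 : R) g (dg h).
  rewrite in_itv /= => /andP[h1 h2].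
  by case: (H h) => //; rewrite !ltW.
have D2 : {within `[a, b], continuous g}.
  apply: derivable_within_continuous => h; rewrite in_itv /= => /H[[gd _] _].
  exact: gd.
have [c] := MVT_segment ab D1 D2.
rewrite in_itv /= => /H[_ cC] ->.
by rewrite ler_wpM2r // subr_ge0.
Qed.

Lemma mvt_dist (g dg : R -> R) (D e s : R) :
  (forall h, `|h| <= `|s| -> is_derive h (1 : R) g (dg h) /\ `|dg h - D| <= e) ->
  `|g s - g 0 - s * D| <= e * `|s|.
Proof.
have main (G dG : R -> R) (a b : R) : a <= b ->
    (forall h, a <= h <= b ->
       is_derive h (1 : R) G (dG h) /\ `|dG h - D| <= e) ->
    `|G b - G a - (b - a) * D| <= e * (b - a).
  move=> ab H.
  have H1 : G b - G a <= (e + D) * (b - a).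
    apply: (@mvt_le G dG) => // h /H[gd]; rewrite ler_distlC => /andP[h1 h2].
    by split=> //; lra.
  have H2 : - G b - - G a <= (e - D) * (b - a).
    apply: (@mvt_le (fun h => - G h) (fun h => - dG h)) => // h /H[gd].
    by rewrite ler_distlC => /andP[h1 h2]; split; [exact: is_deriveN|lra].
  by rewrite ler_norml; apply/andP; split; lra.
move=> H; have [s0|s0] := leP 0 s.
  have := main g dg 0 s s0; rewrite subr0 (ger0_norm s0); apply=> h /andP[h0 hs].
  by apply: H; rewrite !ger0_norm.
have := main g dg s 0 (ltW s0); rewrite sub0r (ltr0_norm s0) => H1.
rewrite -normrN; have -> : - (g s - g 0 - s * D) = g 0 - g s - - s * D by ring.
apply: H1 => h /andP[h0 hs]; apply: H.
by rewrite (ler0_norm hs) (ltr0_norm s0) lerN2.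
Qed.

Lemma Ck_on1_partial_near f x (e : R) k : Ck_on 1 O f -> O x -> 0 < e ->
  \forall y \near x, `|partial k f y - partial k f x| <= e.
Proof.
move=> Cf Ox e0; have := Ck_on_continuous oO (Ck_on_partial k Cf) Ox.
by move=> /cvgrPdist_le/(_ e e0); apply: filterS => y; rewrite distrC.
Qed.

Lemma Ck_on1_partials_near f x (e : R) : Ck_on 1 O f -> O x -> 0 < e ->
  \forall y \near x, O y /\ forall k, `|partial k f y - partial k f x| <= e.
Proof.
move=> Cf Ox e0; apply: filterI; first exact: near_open.
by apply: (@filter_forall _ _ _ (nbhs x) (nbhs_filter x)) => k;
  exact: Ck_on1_partial_near.
Qed.

Lemma dist_telescope (a0 a1 a2 a3 a4 d0 d1 d2 d3 b0 b1 b2 b3 : R) :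
  `|a1 - a0 - d0| <= b0 -> `|a2 - a1 - d1| <= b1 -> `|a3 - a2 - d2| <= b2 ->
  `|a4 - a3 - d3| <= b3 ->
  `|a4 - a0 - (d0 + d1 + d2 + d3)| <= b0 + b1 + b2 + b3.
Proof.
rewrite !ler_norml => /andP[? ?] /andP[? ?] /andP[? ?] /andP[? ?].
by apply/andP; split; lra.
Qed.

(** Go from x to y one coordinate at a time inside a box on which all partial derivatives are
    e-close to those at x, apply the mean value estimate to each of the four legs, and add. *)
Lemma Ck_on1_increment f x (e : R) : Ck_on 1 O f -> O x -> 0 < e ->
  \forall y \near x,
    `|f y - f x - csum (fun k => coord k (y - x) * partial k f x)|
    <= e * csum (fun k => `|coord k (y - x)|).
Proof.
move=> Cf Ox e0.
have [r r0 rP] := nbhs_box (Ck_on1_partials_near Cf Ox e0).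
apply: filterS (box_nbhs x r0) => y yb.
pose st z k := coord k (y - x) *: coord_dir R k + z.
have step z k : box x r z -> coord k z = coord k x ->
    box x r (st z k) /\
    `|f (st z k) - f z - coord k (y - x) * partial k f x|
      <= e * `|coord k (y - x)|.
  move=> zb zk.
  have line h : `|h| <= `|coord k (y - x)| -> box x r (h *: coord_dir R k + z).
    move=> hs j; rewrite coordD coordZ coord_coord_dir.
    have [->|jk] := eqVneq j k; last by rewrite mulr0 add0r.
    rewrite mulr1 zk addrK; apply: le_lt_trans hs _; rewrite coordB.
    exact: yb.
  split; first exact: line.
  have := @mvt_dist (fun h => f (h *: coord_dir R k + z))
    (fun h => partial k f (h *: coord_dir R k + z)) (partial k f x) e
    (coord k (y - x)).
  rewrite scale0r add0r; apply => h /line/rP[Oh kh]; split; last exact: kh.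
  by apply: is_derive_line_at; apply: Ck_on_derivable Cf Oh.
have xb : box x r x by move=> k; rewrite subrr normr0.
have stj z k j : k != j -> coord k z = coord k x -> coord k (st z j) = coord k x.
  by move=> /negbTE kj <-; rewrite coordD coordZ coord_coord_dir kj mulr0 add0r.
have [b0 H0] := step x (Some 0) xb erefl.
have [|b1 H1] := step _ (Some 1) b0; first exact: stj.
have [|b2 H2] := step _ (Some 2) b1; first by rewrite !stj.
have [|b3 H3] := step _ None b2; first by rewrite !stj.
have yE : y = st (st (st (st x (Some 0)) (Some 1)) (Some 2)) None.
  have E a b : (forall k, coord k a = coord k b) -> a = b.
    case: a b => [a s] [b t] ab; congr pair; last exact: (ab None).
    by apply/rowP => i; exact: (ab (Some i)).
  apply: E => k; rewrite !(coordB, coordD, coordZ, coord_coord_dir).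
  case: k => [i|]; last by rewrite /=; ring.
  by have [->|->|->] := ord3P i; rewrite /=; ring.
rewrite -yE in H3.
rewrite /csum !mulrDr; exact: dist_telescope H0 H1 H2 H3.
Qed.

Lemma continuous_line v x : continuous (fun h : R => h *: v + x).
Proof.
move=> h; apply: cvgD; last exact: cvg_cst.
by apply: cvgZr_tmp; exact: cvg_id.
Qed.

Lemma near_line x v (A : set (spacetime R)) : nbhs x A ->
  \forall h \near (0 : R), A (h *: v + x).
Proof.
move=> xA; have := @continuous_line v x 0.
by rewrite /continuous_at scale0r add0r => /(_ A xA).
Qed.

Lemma Ck_on1_dir_derive f x v : Ck_on 1 O f -> O x ->
  is_derive x v f (csum (fun k => coord k v * partial k f x)).
Proof.
move=> Cf Ox; set S := csum _.
pose N := csum (fun k => `|coord k v|).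
have N0 : 0 <= N by rewrite !addr_ge0.
have H : (fun h => h^-1 *: ((f \o shift x) (h *: v) - f x)) @ 0^' --> S.
  apply/cvgrPdist_le => e e0.
  have e1 : 0 < e / (N + 1) by rewrite divr_gt0 // ltr_wpDl.
  have [d /= d0 fd] := near_line v (Ck_on1_increment Cf Ox e1).
  exists d => //= h hd h0; have := fd h hd; rewrite addrK => {}fd.
  have E1 : csum (fun k => coord k (h *: v) * partial k f x) = h * S.
    by rewrite -csumZ; apply: eq_csum => k; rewrite coordZ mulrA.
  have E2 : csum (fun k => `|coord k (h *: v)|) = `|h| * N.
    by rewrite -csumZ; apply: eq_csum => k; rewrite coordZ normrM.
  rewrite E1 E2 in fd.
  change (`|S - h^-1 * (f (h *: v + x) - f x)| <= e).
  move: fd; move: (f _ - f x) => D fd.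
  have -> : S - h^-1 * D = - h^-1 * (D - h * S).
    by rewrite mulrBr !mulNr mulrA mulVf // mul1r opprK addrC.
  rewrite normrM normrN normfV mulrC ler_pdivrMr ?normr_gt0 //.
  apply: le_trans fd _; rewrite mulrCA mulrC ler_wpM2r //.
  rewrite mulrAC ler_pdivrMr ?ltr_wpDl // ler_pM2l //.
  by rewrite lerDl.
apply: DeriveDef; first by apply/cvg_ex; exists S.
exact: cvg_lim H.
Qed.

(** The first-order estimate for each partial derivative controls the derivative of phi along the
    segment from x to y; one mean value step then gives the second order. *)
Lemma taylor2_le phi x (e : R) : Ck_on 2 O phi -> O x -> 0 < e ->
  \forall y \near x,
    phi y <= phi x + csum (fun k => coord k (y - x) * partial k phi x)
      + 2^-1 * csum (fun k => coord k (y - x) *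
          csum (fun j => coord j (y - x) * partial j (partial k phi) x))
      + e * csum (fun k => `|coord k (y - x)|) ^+ 2.
Proof.
move=> Cphi Ox e0.
have C1 k := Ck_on_partial k Cphi.
have A : \forall y \near x, O y /\ forall k,
    `|partial k phi y - partial k phi x
      - csum (fun j => coord j (y - x) * partial j (partial k phi) x)|
    <= e * csum (fun j => `|coord j (y - x)|).
  apply: filterI; first exact: near_open.
  by apply: (@filter_forall _ _ _ (nbhs x) (nbhs_filter x)) => k; exact: Ck_on1_increment.
have [r r0 rP] := nbhs_box A.
apply: filterS (box_nbhs x r0) => y yb.
pose v := y - x; rewrite -/v.
set L := csum (fun k => coord k v * partial k phi x).
set q := csum (fun k => coord k v * csum _).
set N := csum (fun k => `|coord k v|).
have N0 k : `|coord k v| <= N.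
  exact: (@ler_csum (fun k => `|coord k v|)).
(* After subtraction of its second-order expansion, phi along the segment has derivative at most e
   N^2, which bounds g 1 - g 0. *)
pose g h := phi (h *: v + x) - h * L - 2^-1 * h ^+ 2 * q.
pose dg h := csum (fun k => coord k v * partial k phi (h *: v + x)) - L - h * q.
have := @mvt_le g dg 0 1 (e * N ^+ 2) ler01.
rewrite /g scale1r scale0r add0r /v subrK expr0n expr1n /= !(mulr0, mul0r).
rewrite !subr0 mulr1 -/v => H; have {}H := H _.
suff: phi y - 1 * L - 2^-1 * q - phi x <= e * N ^+ 2.
  by lra.
rewrite mulr1 in H; apply: H => h /andP[h0 h1].
have hb : box x r (h *: v + x).
  move=> k; rewrite coordD coordZ addrK normrM (ger0_norm h0).
  apply: le_lt_trans (yb k); rewrite -coordB -/v.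
  by rewrite ler_piMl.
have [Oh Bh] := rP _ hb.
split.
  have H1 := is_derive_line_at (Ck_on1_dir_derive v (Ck_onS Cphi) Oh).
  have H2 : is_derive h (1 : R) (fun h => h * L) L.
    have := is_derive_affine L 0 h; under eq_fun do rewrite addr0 mulrC.
    exact.
  have H3 : is_derive h (1 : R) (fun h => 2^-1 * h ^+ 2 * q) (h * q).
    have Hi := is_derive_id h (1 : R).
    have H3 := is_deriveZ (2^-1 * q) (is_deriveM Hi Hi).
    have {}H3 := is_derive_eq H3 (_ : _ = h * q).
    have -> : (fun h => 2^-1 * h ^+ 2 * q) = (2^-1 * q) *: (id * id : R -> R).
      by apply/funext => t; rewrite expr2 mulrAC.
    apply: H3; change (2^-1 * q * (h * 1 + h * 1) = h * q).
    by field.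
  exact: (is_deriveB (is_deriveB H1 H2) H3).
rewrite /dg.
have aux (a P c d b : R) : a * d <= b ->
    a * (P + h * c + d) <= a * P + h * (a * c) + b by move=> ?; lra.
have K k : coord k v * partial k phi (h *: v + x) <=
    coord k v * partial k phi x
    + h * (coord k v * csum (fun j => coord j v * partial j (partial k phi) x))
    + `|coord k v| * (e * N).
  have := Bh k; rewrite addrK.
  have -> : csum (fun j => coord j (h *: v) * partial j (partial k phi) x) =
      h * csum (fun j => coord j v * partial j (partial k phi) x).
    by rewrite -csumZ; apply: eq_csum => j; rewrite coordZ mulrA.
  have -> : csum (fun j => `|coord j (h *: v)|) = h * N.
    by rewrite -csumZ; apply: eq_csum => j; rewrite coordZ normrM (ger0_norm h0).
  set d := _ - _ - _ => dle.
  have -> : partial k phi (h *: v + x) = partial k phi x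
      + h * csum (fun j => coord j v * partial j (partial k phi) x) + d.
    rewrite /d; move: (csum _) (partial k phi (h *: v + x)) => a b; ring.
  apply: aux; apply: le_trans (ler_norm _) _.
  rewrite normrM ler_wpM2l //; apply: le_trans dle _.
  rewrite ler_pM2l // ler_piMl //; exact: le_trans (N0 None).
have := le_csum K; rewrite !csumD csumZ -/L -/q.
rewrite (@eq_csum (fun k => `|coord k v| * (e * N)) (fun k => e * N * `|coord k v|)).
  rewrite csumZ -/N -mulrA -expr2 2!lerBlDr.
  by move/le_trans; apply; rewrite [L + _]addrC [leLHS]addrC addrA.
by move=> k; rewrite mulrC.
Qed.

End increments.

(** * Constancy of the side of a level along connected sublevel points *)

Section side.
Context (R : realType) (O : set (spacetime R)).
Hypothesis oO : open O.
Implicit Types (phi u : spacetime R -> R) (x y w : spacetime R).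

Lemma csum_coord_dir a k (F : option 'I_3 -> R) :
  csum (fun j => coord j (a *: coord_dir R k) * F j) = a * F k.
Proof.
rewrite /csum !coordZ !coord_coord_dir.
case: k => [i|]; last by rewrite /=; ring.
by have [->|->|->] := ord3P i; rewrite /=; ring.
Qed.

Lemma segment_side u w y (c : R) : (forall x, O x -> {for x, continuous u}) ->
  (forall h, 0 <= h <= 1 -> O (h *: w + y) /\ u (h *: w + y) <> c) ->
  (u y < c) = (u (w + y) < c).
Proof.
move=> cu H.
pose g h := u (h *: w + y).
have cg : {within `[0, 1], continuous g}.
  apply: continuous_in_subspaceT => h; rewrite inE /= in_itv /= => /H[Oh _].
  apply: (@continuous_comp _ _ _ (fun h : R => h *: w + y) u h).
    exact: continuous_line.
  exact: cu.
have g0 : g 0 = u y by rewrite /g scale0r add0r.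
have g1 : g 1 = u (w + y) by rewrite /g scale1r.
rewrite -g0 -g1.
have nc : ~ (Num.min (g 0) (g 1) <= c <= Num.max (g 0) (g 1)).
  by move=> /(IVT ler01 cg)[h]; rewrite in_itv /= => /H[_ uc] /uc.
have [_ n0] := H 0 (introT andP (conj (lexx 0) ler01)).
have [_ n1] := H 1 (introT andP (conj ler01 (lexx 1))).
apply/idP/idP => h.
  rewrite ltNge; apply/negP => h1; apply: nc.
  by rewrite ge_min le_max (ltW h) h1 orbT.
rewrite ltNge; apply/negP => h1; apply: nc.
by rewrite ge_min le_max (ltW h) h1 orbT.
Qed.

(* Moving from a point of {phi < phi x} near x in a coordinate direction along
   which phi decreases leads, inside {phi < phi x}, to a fixed ball. *)
Lemma level_one_side u phi x (c : R) k : Ck_on 1 O phi -> O x ->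
  (forall x, O x -> {for x, continuous u}) -> partial k phi x != 0 ->
  (forall y, O y -> phi y < phi x -> u y <> c) ->
  (\forall y \near x, phi y < phi x -> u y < c) \/
  (\forall y \near x, phi y < phi x -> c < u y).
Proof.
move=> Cphi Ox cu pk uc.
(* The sign for which moving by [sg] in direction k decreases phi. *)
pose sg : R := - Num.sg (partial k phi x).
have sg1 : `|sg| = 1 by rewrite normrN normr_sg pk.
have pm : sg * partial k phi x = - `|partial k phi x|.
  by rewrite mulNr -normrEsg.
have p0 : 0 < `|partial k phi x| / 2 by rewrite divr_gt0 ?normr_gt0.
have [r r0 rP] := nbhs_box (Ck_on1_partials_near oO Cphi Ox p0).
have dec y : box x r y -> sg * partial k phi y < 0.
  move=> /rP[_ /(_ k) d].
  have -> : partial k phi y =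
      partial k phi x + (partial k phi y - partial k phi x) by ring.
  rewrite mulrDr pm; apply: le_lt_trans (lerD (lexx _) (ler_norm _)) _.
  rewrite normrM sg1 mul1r; lra.
(* Starting in the box of radius s and moving by at most s keeps the path in the box of radius r,
   where the decrease is guaranteed. *)
have [s s0 rs] : exists2 s, 0 < s & r = s + s.
  by exists (r / 2); [rewrite divr_gt0|field].
pose w := (s * sg) *: coord_dir R k.
have wcoord j h : 0 <= h <= 1 -> `|coord j (h *: w)| <= s.
  move=> /andP[h0 h1]; rewrite /w !coordZ coord_coord_dir !normrM sg1 mulr1.
  rewrite (gtr0_norm s0) (ger0_norm h0) mulrCA.
  rewrite ler_piMr ?(ltW s0) // normr_nat; case: (j == k); rewrite ?mulr1 //.
  by rewrite mulr0 ler01.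
have wbox y h : box x s y -> 0 <= h <= 1 -> box x r (h *: w + y).
  move=> yb hh j; rewrite coordD -addrA.
  apply: le_lt_trans (ler_normD _ _) _.
  by rewrite rs; apply: ler_ltD; [exact: wcoord|exact: yb].
have mono y h : box x s y -> 0 < h <= 1 -> phi (h *: w + y) < phi y.
  move=> yb /andP[h0 h1].
  have H t : t \in `]0, h[ -> is_derive t (1 : R) (fun h => phi (h *: w + y))
      (s * (sg * partial k phi (t *: w + y))).
    rewrite in_itv /= => /andP[t0 th].
    have tb : box x r (t *: w + y).
      by apply: wbox => //; rewrite (ltW t0) (le_trans (ltW th) h1).
    have [Ot _] := rP _ tb.
    have := is_derive_line_at (Ck_on1_dir_derive oO w Cphi Ot).
    set S := csum _; suff -> : S = s * (sg * partial k phi (t *: w + y)) by [].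
    by rewrite /S csum_coord_dir -mulrA.
  have cg : {within `[0, h], continuous (fun h => phi (h *: w + y))}.
    apply: continuous_in_subspaceT => t; rewrite inE /= in_itv /= => /andP[t0 th].
    apply: (@continuous_comp _ _ _ (fun h : R => h *: w + y) phi t).
      exact: continuous_line.
    have [Ot _] : O (t *: w + y) /\ True.
      by split=> //; have [] := rP (t *: w + y); first by
        apply: wbox => //; rewrite t0 (le_trans th).
    exact: Ck_on_continuous Cphi Ot.
  have [t th] := MVT h0 H cg.
  rewrite scale0r add0r subr0 => E.
  rewrite -subr_lt0 E pmulr_llt0 // pmulr_rlt0 //.
  move: th; rewrite in_itv /= => /andP[t0 th].
  by apply: dec; apply: wbox => //; rewrite (ltW t0) (le_trans (ltW th) h1).
have xs : box x s x by move=> j; rewrite subrr normr0.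
pose x1 := w + x.
have x1lt : phi x1 < phi x.
  by have := mono x 1 xs; rewrite scale1r lexx ltr01; apply.
have Ox1 : O x1.
  have : box x r (1 *: w + x) by apply: wbox => //; rewrite lexx ler01.
  by rewrite scale1r => /rP[].
have [q q0 qP] : exists2 q : R, 0 < q &
    box x1 q `<=` [set y | O y /\ phi y < phi x].
  apply: nbhs_box; apply: filterI; first exact: near_open.
  have := Ck_on_continuous oO Cphi Ox1.
  by move=> /(_ [set t | t < phi x]); apply; exact: lt_nbhsl.
(* The path has two straight pieces: from y to w + y, along which phi decreases, then from w + y to
   x1 inside the box around x1 where phi < phi x. The second piece stays there because w + y is as
   close to x1 as y is to x. *)
have sd y : box x (Num.min s q) y -> phi y < phi x -> (u y < c) = (u x1 < c).
  move=> yb yx.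
  have ys : box x s y by move=> j; apply: lt_le_trans (yb j) _; rewrite ge_min lexx.
  have yq j : `|coord j y - coord j x| < q.
    by apply: lt_le_trans (yb j) _; rewrite ge_min lexx orbT.
  rewrite (@segment_side u w y c cu); last first.
    move=> h hh; have [Oh _] := rP _ (wbox y h ys hh); split=> //.
    apply: uc => //; move: hh => /andP[h0 h1].
    have [->|hn0] := eqVneq h 0; first by rewrite scale0r add0r.
    by apply: lt_trans yx; apply: mono => //; rewrite lt_neqAle eq_sym hn0 h0.
  have -> : x1 = (x - y) + (w + y) by rewrite /x1 addrCA subrK.
  apply: segment_side => // h /andP[h0 h1].
  have [Oh ph] : O (h *: (x - y) + (w + y)) /\ phi (h *: (x - y) + (w + y)) < phi x.
    apply: qP => j; rewrite /x1 !(coordB, coordD, coordZ).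
    have E (a b d : R) : h * (a - b) + (d + b) - (d + a) = (1 - h) * (b - a).
      by ring.
    rewrite E.
    rewrite normrM ger0_norm ?subr_ge0 //.
    apply: le_lt_trans (yq j); rewrite ler_piMl //.
    by rewrite gerBl.
  by split=> //; apply: uc.
have sq : 0 < Num.min s q by rewrite lt_min s0 q0.
case: (ltP (u x1) c) => cx1; [left|right].
  by apply: filterS (box_nbhs x sq) => y yb yx; rewrite (sd y yb yx).
apply: filterS (filterI (near_open oO Ox) (box_nbhs x sq)) => y [Oy yb] yx.
have := sd y yb yx; rewrite (ltNge (u x1)) cx1 /= => /negbT; rewrite -leNgt.
rewrite le_eqVlt => /orP[/eqP cE|//].
by case: (uc y Oy yx).
Qed.

End side.

(** * Mechanical computation of the derivatives of explicit functions *)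

Section derivations.
Context (R : realType) (O : set (spacetime R)).
Hypothesis oO : open O.
Implicit Types (f g : spacetime R -> R) (x : spacetime R).

(** The comparison functions are polynomials in a few functions whose derivatives along X1, X2 and t
    are known; the rules for constants, sums and products then compute theirs by proof search. *)
Definition hder f f1 f2 f0 := smooth_on O f /\ forall x, O x ->
  [/\ horizX 0 f x = f1 x, horizX 1 f x = f2 x & partial None f x = f0 x].

Lemma partial_cst k (c : R) x : partial k (fun=> c) x = 0.
Proof. exact: derive_cst. Qed.

Lemma partialD k f g x : smooth_on O f -> smooth_on O g -> O x ->
  partial k (fun y => f y + g y) x = partial k f x + partial k g x.
Proof.
move=> Cf Cg Ox.
by case: (is_deriveD (smooth_on_is_derive k Cf Ox) (smooth_on_is_derive k Cg Ox)).
Qed.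

Lemma horizXD i f g x : smooth_on O f -> smooth_on O g -> O x ->
  horizX i (fun y => f y + g y) x = horizX i f x + horizX i g x.
Proof.
by move=> Cf Cg Ox; rewrite !horizXE !(partialD _ Cf Cg Ox) mulrDr addrACA.
Qed.

Lemma hder_cst (c : R) : hder (fun=> c) (fun=> 0) (fun=> 0) (fun=> 0).
Proof.
split=> [|x Ox]; first exact: smooth_on_cst.
by rewrite !horizXE !partial_cst mulr0 mulr0 !addr0.
Qed.

Lemma hderD f f1 f2 f0 g g1 g2 g0 : hder f f1 f2 f0 -> hder g g1 g2 g0 ->
  hder (fun x => f x + g x) (fun x => f1 x + g1 x) (fun x => f2 x + g2 x)
    (fun x => f0 x + g0 x).
Proof.
move=> [Cf Hf] [Cg Hg]; split=> [|x Ox]; first exact: smooth_onD.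
have [F1 F2 F0] := Hf x Ox; have [G1 G2 G0] := Hg x Ox.
by rewrite !(horizXD _ Cf Cg Ox) (partialD _ Cf Cg Ox) F1 F2 F0 G1 G2 G0.
Qed.

Lemma hderM f f1 f2 f0 g g1 g2 g0 : hder f f1 f2 f0 -> hder g g1 g2 g0 ->
  hder (fun x => f x * g x) (fun x => f x * g1 x + g x * f1 x)
    (fun x => f x * g2 x + g x * f2 x) (fun x => f x * g0 x + g x * f0 x).
Proof.
move=> [Cf Hf] [Cg Hg]; split=> [|x Ox]; first exact: smooth_onM.
have [F1 F2 F0] := Hf x Ox; have [G1 G2 G0] := Hg x Ox.
by rewrite !(horizXM _ Cf Cg Ox) (partialM _ Cf Cg Ox) F1 F2 F0 G1 G2 G0.
Qed.

Lemma eq_hder f f1 f2 f0 g1 g2 g0 : hder f f1 f2 f0 ->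
  (forall x, O x -> [/\ f1 x = g1 x, f2 x = g2 x & f0 x = g0 x]) ->
  hder f g1 g2 g0.
Proof.
by move=> [Cf Hf] fg; split=> // x Ox; have [<- <- <-] := fg x Ox; apply: Hf.
Qed.

End derivations.

(** * Strictness: persistence near a point, and the model functions *)

Section strict.
Context (R : realType).

(** From 2 p r B >= - |B| (p^2 + r^2). The bound does not depend on the direction of eta, which is
    uncontrolled where the gradient of the model degenerates. *)
Lemma mcf_op_ge (eta : 'rV[R]_2) (Y : 'M[R]_2) : eta != 0 ->
  0 <= Y 0 0 -> 0 <= Y 1 1 -> Y 1 0 = Y 0 1 ->
  - (Y 0 0 + Y 1 1 + `|Y 0 1|) <= mcf_op eta Y.
Proof.
rewrite rV2_neq0 mcf_opE => e0 Y0 Y1 ->.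
move: (eta 0 0) (eta 0 1) (Y 0 0) (Y 0 1) (Y 1 1) e0 Y0 Y1 => p r A B C e0 A0 C0.
have H : - `|B| <= (p ^+ 2 * A + p * r * (B + B) + r ^+ 2 * C) / (p ^+ 2 + r ^+ 2).
  rewrite ler_pdivlMr //.
  have p2 := sqr_ge0 p; have r2 := sqr_ge0 r.
  have H1 : 0 <= p ^+ 2 * A by rewrite mulr_ge0.
  have H2 : 0 <= r ^+ 2 * C by rewrite mulr_ge0.
  have [B0|B0] := leP 0 B.
    have H3 : 0 <= B * (p + r) ^+ 2 by rewrite mulr_ge0 ?sqr_ge0.
    by rewrite (ger0_norm B0); lra.
  have H3 : 0 <= - B * (p - r) ^+ 2.
    by rewrite mulr_ge0 ?sqr_ge0 // oppr_ge0 ltW.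
  by rewrite (ltr0_norm B0); lra.
by lra.
Qed.

(** Away from eta = 0 the operator is a continuous expression in the derivatives, so both strict
    inequalities are open conditions. *)
Lemma strict_super_near (O : set (spacetime R)) (f : spacetime R -> R) x :
  open O -> smooth_on O f -> O x -> gradH f x != 0 ->
  0 < partial None f x + mcf_op (gradH f x) (hessH f x) ->
  \forall y \near x, strict_super f y.
Proof.
move=> oO Cf Ox g0 S0.
have c1 i : {for x, continuous (fun y => gradH f y 0 i)}.
  have := smooth_on_continuous oO (smooth_on_horizX oO i Cf) Ox.
  by rewrite (_ : horizX i f = fun y => gradH f y 0 i) //;
    apply/funext => y; rewrite mxE.
have c2 i j : {for x, continuous (fun y => hessH f y i j)}.
  have Cij k l := smooth_on_continuous oO
    (smooth_on_horizX oO k (smooth_on_horizX oO l Cf)) Ox.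
  have -> : (fun y => hessH f y i j) = (fun y => 2^-1 *
      (horizX i (horizX j f) y + horizX j (horizX i f) y)).
    by apply/funext => y; rewrite mxE.
  apply: continuousM; first exact: cst_continuous.
  exact: continuousD.
have cN : {for x, continuous
    (fun y => gradH f y 0 0 ^+ 2 + gradH f y 0 1 ^+ 2)}.
  exact: (continuousD (continuousM (c1 0) (c1 0)) (continuousM (c1 1) (c1 1))).
have N0 := g0; rewrite rV2_neq0 in N0.
have cS : {for x, continuous
    (fun y => partial None f y + ((gradH f y 0 0 ^+ 2 * hessH f y 0 0
      + gradH f y 0 0 * gradH f y 0 1 * (hessH f y 0 1 + hessH f y 1 0)
      + gradH f y 0 1 ^+ 2 * hessH f y 1 1)
        / (gradH f y 0 0 ^+ 2 + gradH f y 0 1 ^+ 2)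
      - (hessH f y 0 0 + hessH f y 1 1)))}.
  have cP := smooth_on_continuous oO (smooth_on_partial None Cf) Ox.
  have k1 := continuousM (continuousM (c1 0) (c1 0)) (c2 0 0).
  have k2 := continuousM (continuousM (c1 0) (c1 1)) (continuousD (c2 0 1) (c2 1 0)).
  have k3 := continuousM (continuousM (c1 1) (c1 1)) (c2 1 1).
  have k4 : {for x, continuous
      (fun y => (gradH f y 0 0 ^+ 2 + gradH f y 0 1 ^+ 2)^-1)}.
    by apply: continuousV; [exact: lt0r_neq0|exact: cN].
  exact: (continuousD cP (continuousB
    (continuousM (continuousD (continuousD k1 k2) k3) k4)
    (continuousD (c2 0 0) (c2 1 1)))).
have n1 : \forall y \near x, 0 < gradH f y 0 0 ^+ 2 + gradH f y 0 1 ^+ 2.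
  by apply: (cN [set t | 0 < t]); exact: lt_nbhsr.
have n2 : \forall y \near x,
    0 < partial None f y + mcf_op (gradH f y) (hessH f y).
  rewrite mcf_opE in S0; have H := cS [set t | 0 < t] (lt_nbhsr S0).
  near=> y; rewrite mcf_opE; near: y; exact: H.
apply: filterS (filterI n1 n2) => y [y1 y2]; left; split=> //.
by rewrite rV2_neq0.
Unshelve. all: by end_near. Qed.

End strict.

(* In applications h1, h2, z are left-translated Heisenberg coordinates, tau is
   the time and q is a barrier at t = 0, all vanishing at the base point. *)
Section model_function.
Context (R : realType) (O : set (spacetime R)).
Hypothesis oO : open O.
Context (h1 h2 z tau q dq : spacetime R -> R).
Hypothesis h1d : hder O h1 (fun=> 1) (fun=> 0) (fun=> 0).
Hypothesis h2d : hder O h2 (fun=> 0) (fun=> 1) (fun=> 0).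
Hypothesis zd : hder O z (fun x => - 2^-1 * h2 x) (fun x => 2^-1 * h1 x) (fun=> 0).
Hypothesis taud : hder O tau (fun=> 0) (fun=> 0) (fun=> 1).
Hypothesis qd : hder O q (fun=> 0) (fun=> 0) dq.
Context (al1 al2 y11 y12 y22 b a K : R).

(** A second-order polynomial with prescribed coefficients plus K (|h|^4 + z^2 + tau^2), homogeneous
    of degree 4 when h has weight 1 and z, tau weight 2. The K-terms change neither the horizontal
    derivatives up to order two nor the time derivative at the base point, so K can be taken as
    large as desired. *)
Definition model x : R :=
  al1 * h1 x + al2 * h2 x
  + 2^-1 * (y11 * (h1 x * h1 x) + 2 * y12 * (h1 x * h2 x) + y22 * (h2 x * h2 x))
  + b * z x + a * tau x
  + K * ((h1 x * h1 x + h2 x * h2 x) * (h1 x * h1 x + h2 x * h2 x))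
  + K * (z x * z x + tau x * tau x) + q x.

Definition model1 x : R :=
  al1 + y11 * h1 x + y12 * h2 x - 2^-1 * b * h2 x
  + 4 * K * ((h1 x * h1 x + h2 x * h2 x) * h1 x) - K * (z x * h2 x).

Definition model2 x : R :=
  al2 + y12 * h1 x + y22 * h2 x + 2^-1 * b * h1 x
  + 4 * K * ((h1 x * h1 x + h2 x * h2 x) * h2 x) + K * (z x * h1 x).

Definition model0 x : R := a + 2 * K * tau x + dq x.

Ltac hder_tac :=
  repeat first [exact: hder_cst | exact h1d | exact h2d | exact zd
    | exact taud | exact qd
    | apply: (hderD oO) | apply: (hderM oO)].

Lemma hder_model : hder O model model1 model2 model0.
Proof.
rewrite /model; apply: eq_hder; first by hder_tac.
move=> x _; rewrite /model1 /model2 /model0 /=.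
move: (h1 x) (h2 x) (z x) (tau x) (dq x) (q x) => A B C D E F.
by split; field.
Qed.

Lemma hder_model1 : hder O model1
  (fun x => y11 + 4 * K * (h1 x * h1 x + h2 x * h2 x)
     + 8 * K * (h1 x * h1 x) + 2^-1 * K * (h2 x * h2 x))
  (fun x => y12 - 2^-1 * b + 8 * K * (h1 x * h2 x) - K * z x
     - 2^-1 * K * (h1 x * h2 x))
  (fun=> 0).
Proof.
(* Differences become sums with negative coefficients, the form that the rules for [hder]
   recognize. *)
have -> : model1 = fun x => al1 + y11 * h1 x + y12 * h2 x + (- (2^-1 * b)) * h2 x
    + 4 * K * ((h1 x * h1 x + h2 x * h2 x) * h1 x) + (- K) * (z x * h2 x).
  by apply/funext => x; rewrite !mulNr.
apply: eq_hder; first by hder_tac.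
move=> x _ /=; move: (h1 x) (h2 x) (z x) => A B C.
by split; field.
Qed.

Lemma hder_model2 : hder O model2
  (fun x => y12 + 2^-1 * b + 8 * K * (h1 x * h2 x) + K * z x
     - 2^-1 * K * (h1 x * h2 x))
  (fun x => y22 + 4 * K * (h1 x * h1 x + h2 x * h2 x)
     + 8 * K * (h2 x * h2 x) + 2^-1 * K * (h1 x * h1 x))
  (fun=> 0).
Proof.
rewrite /model2; apply: eq_hder; first by hder_tac.
move=> x _ /=; move: (h1 x) (h2 x) (z x) => A B C.
by split; field.
Qed.

Lemma gradH_model x : O x ->
  gradH model x 0 0 = model1 x /\ gradH model x 0 1 = model2 x.
Proof. by move=> Ox; have [_ /(_ x Ox)[E1 E2 _]] := hder_model; rewrite !mxE. Qed.

Lemma partial_model x : O x -> partial None model x = model0 x.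
Proof. by move=> Ox; have [_ /(_ x Ox)[_ _ ->]] := hder_model. Qed.

(** The terms in b and K z come with opposite signs in X1 X2 and X2 X1, a trace of the commutator,
    and cancel in the symmetrization. *)
Lemma hessH_model x : O x ->
  [/\ hessH model x 0 0 = y11 + 4 * K * (h1 x * h1 x + h2 x * h2 x)
       + 8 * K * (h1 x * h1 x) + 2^-1 * K * (h2 x * h2 x),
      hessH model x 0 1 = y12 + 2^-1 * (15 * K) * (h1 x * h2 x),
      hessH model x 1 0 = hessH model x 0 1 &
      hessH model x 1 1 = y22 + 4 * K * (h1 x * h1 x + h2 x * h2 x)
       + 8 * K * (h2 x * h2 x) + 2^-1 * K * (h1 x * h1 x)].
Proof.
move=> Ox; rewrite !mxE.
have E1 y : O y -> horizX 0 model y = model1 y.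
  by move=> Oy; have [_ /(_ y Oy)[-> _ _]] := hder_model.
have E2 y : O y -> horizX 1 model y = model2 y.
  by move=> Oy; have [_ /(_ y Oy)[_ -> _]] := hder_model.
rewrite !(horizX_congr oO _ E1 Ox) !(horizX_congr oO _ E2 Ox).
have [_ /(_ x Ox)[-> -> _]] := hder_model1.
have [_ /(_ x Ox)[-> -> _]] := hder_model2.
by move: (h1 x) (h2 x) (z x) => A B C; split; field.
Qed.

(* At a point where the first two orders vanish, h.grad model = 4K|h|^4, so the
   gradient degenerates only where h = 0, and there the Hessian vanishes. *)
Lemma strict_super_model x e : al1 = 0 -> al2 = 0 -> y11 = 0 -> y12 = 0 ->
  y22 = 0 -> O x -> 0 < K -> 100 * e <= a ->
  K * (h1 x * h1 x + h2 x * h2 x) < 2 * e -> K * `|tau x| < 3 * e ->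
  `|dq x| < e -> strict_super model x.
Proof.
move=> l1 l2 Y11 Y12 Y22 Ox K0 ea hh ht hq.
have [G1 G2] := gradH_model Ox; have [H00 H01 H10 H11] := hessH_model Ox.
have P0 := partial_model Ox.
rewrite /strict_super; move: G1 G2 H00 H01 H10 H11 P0.
move: (gradH model x) (hessH model x) (partial None model x) => g H p.
rewrite /model1 /model2 /model0 l1 l2 Y11 Y12 Y22; move: hh ht hq.
move: (h1 x) (h2 x) (z x) (tau x) (dq x) => A B C T D hh ht hq.
move=> G1 G2 H00 H01 H10 H11 P0.
have A2 : 0 <= K * (A * A) by rewrite mulr_ge0 ?(ltW K0) // -expr2 sqr_ge0.
have B2 : 0 <= K * (B * B) by rewrite mulr_ge0 ?(ltW K0) // -expr2 sqr_ge0.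
have KT : - (3 * e) < K * T.
  have : - (K * `|T|) <= K * T by rewrite -mulrN ler_pM2l // lerNnormlW.
  by lra.
have Dq : - e < D by move: hq; rewrite ltr_norml => /andP[].
(* The time derivative exceeds 100 e - 6 e - e, while the trace and the off-diagonal entry together
   are at most (33/2 + 15/4) K |h|^2 < 41 e. *)
have p90 : 90 * e < p by rewrite P0; lra.
have e0 : 0 < e by lra.
have [g_eq0|gn0] := eqVneq g 0; [right|left].
  have h0 : A * A + B * B = 0.
    move: G1 G2; rewrite g_eq0 !mxE => G1 G2.
    have H1 := congr1 (fun v => A * v) G1; have H2 := congr1 (fun v => B * v) G2.
    have : 4 * K * ((A * A + B * B) * (A * A + B * B)) = 0.
      by move: H1 H2 => /= H1 H2; lra.
    move=> /eqP; rewrite !mulf_eq0 orbb pnatr_eq0 /=.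
    by rewrite (gt_eqF K0) /= => /eqP.
  have [A0 B0] : A = 0 /\ B = 0.
    move/eqP: h0; rewrite paddr_eq0 -?expr2 ?sqr_ge0 // !sqrf_eq0.
    by move=> /andP[/eqP -> /eqP ->].
  split=> //; last by lra.
  move: H10; rewrite H01 A0 B0 !(mulr0, addr0) => H10.
  move: H00 H11; rewrite A0 B0 !(mulr0, addr0) => H00 H11.
  rewrite A0 B0 !(mulr0, addr0) in H01.
  apply/matrixP => i j; rewrite mxE.
  have I2 (k : 'I_2) : k = 0 \/ k = 1.
    by case: k => -[|[|]] // hk; [left|right]; apply: val_inj.
  by case: (I2 i) (I2 j) => -> [] ->.
split=> //.
have Y0 : 0 <= H 0 0 by rewrite H00; lra.
have Y1 : 0 <= H 1 1 by rewrite H11; lra.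
have := mcf_op_ge gn0 Y0 Y1 H10.
have nB : `|H 0 1| <= 2^-1 * (15 * K) * (2^-1 * (A * A + B * B)).
  rewrite H01 add0r normrM ger0_norm; last by rewrite !mulr_ge0 ?(ltW K0) // invr_ge0.
  apply: ler_wpM2l; first by rewrite !mulr_ge0 ?(ltW K0) // invr_ge0.
  have S1 := sqr_ge0 (A - B); have S2 := sqr_ge0 (A + B).
  by rewrite ler_norml; apply/andP; split; lra.
rewrite H00 H11; move: nB p90 hh A2 B2; move: `|H 0 1| => nB.
by lra.
Qed.

End model_function.

(** * Confinement and coercivity of the model functions *)

Section model_growth.
Context (R : realType).

Definition model_low (al1 al2 y11 y12 y22 b a h1 h2 z t : R) : R :=
  al1 * h1 + al2 * h2
  + 2^-1 * (y11 * (h1 * h1) + 2 * y12 * (h1 * h2) + y22 * (h2 * h2))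
  + b * z + a * t.

Definition model_high (K h1 h2 z t : R) : R :=
  K * ((h1 * h1 + h2 * h2) * (h1 * h1 + h2 * h2)) + K * (z * z + t * t).

Lemma model_low_bound (al1 al2 y11 y12 y22 b a : R) :
  exists2 M, 0 <= M & forall h1 h2 z t m : R,
    `|h1| <= m -> `|h2| <= m -> `|z| <= m -> `|t| <= m ->
    - (M * (m + m ^+ 2)) <= model_low al1 al2 y11 y12 y22 b a h1 h2 z t.
Proof.
exists (`|al1| + `|al2| + `|y11| + 2 * `|y12| + `|y22| + `|b| + `|a|).
  by rewrite !addr_ge0 // mulr_ge0.
move=> h1 h2 z t m H1 H2 Hz Ht.
have m0 : 0 <= m by apply: le_trans H1.
have lin (c v : R) : `|v| <= m -> - (`|c| * m) <= c * v.
  move=> vm; rewrite lerNl; apply: le_trans (ler_norm _) _.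
  by rewrite normrN normrM ler_wpM2l.
have quad (c v w : R) : `|v| <= m -> `|w| <= m -> - (`|c| * m ^+ 2) <= c * (v * w).
  move=> vm wm; rewrite lerNl; apply: le_trans (ler_norm _) _.
  by rewrite normrN normrM ler_wpM2l // normrM expr2 ler_pM.
have := lin al1 _ H1; have := lin al2 _ H2; have := lin b _ Hz.
have := lin a _ Ht; have := quad y11 _ _ H1 H1; have := quad y22 _ _ H2 H2.
have := quad y12 _ _ H1 H2.
have pos1 (c : R) : 0 <= `|c| * m by rewrite mulr_ge0.
have pos2 (c : R) : 0 <= `|c| * m ^+ 2 by rewrite mulr_ge0 ?sqr_ge0.
have := pos2 al1; have := pos2 al2; have := pos2 b; have := pos2 a.
have := pos1 y11; have := pos1 y12; have := pos1 y22.
have := pos2 y11; have := pos2 y12; have := pos2 y22.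
rewrite /model_low.
move: `|al1| `|al2| `|y11| `|y12| `|y22| `|b| `|a|.
by move=> *; lra.
Qed.

Lemma max4P (a b c d : R) : exists m, [/\ a <= m, b <= m, c <= m, d <= m &
  [\/ m = a, m = b, m = c | m = d]].
Proof.
exists (Num.max (Num.max a b) (Num.max c d)).
rewrite !le_max !lexx !orbT; split=> //.
case: (leP a b) => _; case: (leP c d) => _; case: leP => _.
all: by [apply: Or41|apply: Or42|apply: Or43|apply: Or44].
Qed.

(** m is the largest of the four absolute values. If an h-coordinate attains it, the growth is
    quartic, otherwise quadratic; the weaker of the two is m^4 for m <= 1 and m^2 for m >= 1. *)
Lemma model_high_bound (K h1 h2 z t : R) : 0 <= K ->
  exists m, [/\ `|h1| <= m, `|h2| <= m, `|z| <= m, `|t| <= m &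
    (m <= 1 -> K * m ^+ 4 <= model_high K h1 h2 z t) /\
    (1 <= m -> K * m ^+ 2 <= model_high K h1 h2 z t)].
Proof.
move=> K0; have [m [H1 H2 Hz Ht Hm]] := max4P `|h1| `|h2| `|z| `|t|.
exists m; split=> //.
rewrite /model_high -mulrDr.
suff [N2|N4] : m ^+ 2 <= z * z + t * t \/
   m ^+ 4 <= (h1 * h1 + h2 * h2) * (h1 * h1 + h2 * h2).
- have m0 : 0 <= m by apply: le_trans H1.
  have P : 0 <= (h1 * h1 + h2 * h2) * (h1 * h1 + h2 * h2).
    by rewrite -expr2 sqr_ge0.
  split=> m1; rewrite ler_wpM2l //; last by lra.
  apply: (@le_trans _ _ (m ^+ 2)); last by lra.
  by apply: ler_wiXn2l.
- have m0 : 0 <= m by apply: le_trans H1.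
  have P : 0 <= z * z + t * t by rewrite addr_ge0 // -expr2 sqr_ge0.
  split=> m1; rewrite ler_wpM2l //; first by lra.
  apply: (@le_trans _ _ (m ^+ 4)); last by lra.
  by apply: ler_weXn2l.
have sq (v : R) : `|v| ^+ 2 = v * v by rewrite real_normK ?num_real // expr2.
have s1 := sqr_ge0 h1; have s2 := sqr_ge0 h2; have s3 := sqr_ge0 z.
have s4 := sqr_ge0 t; rewrite !expr2 in s1 s2 s3 s4.
have fourth (v w : R) : 0 <= w * w -> v ^+ 4 <= (v * v + w * w) * (v * v + w * w).
  move=> w0; have v0 := sqr_ge0 v; rewrite expr2 in v0.
  have -> : v ^+ 4 = (v * v) * (v * v) by rewrite -!expr2 -exprM.
  by rewrite ler_pM // lerDl.
have fourth_norm (v : R) : `|v| ^+ 4 = v ^+ 4.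
  by rewrite -[4%N]/((2 * 2)%N) !exprM real_normK ?num_real.
case: Hm => ->; rewrite ?fourth_norm ?sq.
- by right; apply: fourth.
- by right; rewrite [h1 * h1 + _]addrC; apply: fourth.
- by left; lra.
- by left; lra.
Qed.

(** As K grows, the set where the model is nonpositive shrinks to the base point; this brings it
    into the region where the local Taylor estimate is valid. *)
Lemma model_confined (al1 al2 y11 y12 y22 b a r : R) : 0 < r -> r <= 1 ->
  exists2 K0, 0 < K0 & forall K h1 h2 z t : R, K0 <= K ->
    model_low al1 al2 y11 y12 y22 b a h1 h2 z t
      + model_high K h1 h2 z t <= 0 ->
    [/\ `|h1| < r, `|h2| < r, `|z| < r & `|t| < r].
Proof.
move=> r0 r1; have [M M0 HM] := model_low_bound al1 al2 y11 y12 y22 b a.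
have r30 : 0 < r ^+ 3 by rewrite exprn_gt0.
have r31 : r ^+ 3 <= 1 by rewrite exprn_ile1 // ltW.
(* If r <= m <= 1, then M (m + m^2) <= 2 M m < K r^3 m <= K m^4; if m >= 1, then 2 M m^2 < K m^2. *)
exists (2 * M / r ^+ 3 + 1); first by rewrite ltr_wpDl // divr_ge0 ?mulr_ge0 // ltW.
move=> K h1 h2 z t KK P0.
have Kr : 2 * M + r ^+ 3 <= K * r ^+ 3.
  by move: KK; rewrite -(ler_pM2r r30) mulrDl divfK ?gt_eqF // mul1r.
have K0 : 0 < K.
  apply: lt_le_trans KK; by rewrite ltr_wpDl // divr_ge0 ?mulr_ge0 // ltW.
have [m [H1 H2 Hz Ht [Ha Hb]]] := model_high_bound h1 h2 z t (ltW K0).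
have low := HM _ _ _ _ _ H1 H2 Hz Ht.
suff mr : m < r by split; apply: le_lt_trans mr.
rewrite ltNge; apply/negP => rm.
have m0 : 0 < m by apply: lt_le_trans rm.
case: (leP m 1) => [m1|/ltW m1].
  have := Ha m1; rewrite leNgt => /negP; apply.
  have m2 : m ^+ 2 <= m by rewrite expr2 ler_piMr // ltW.
  have X : M * (m + m ^+ 2) <= 2 * M * m.
    by rewrite [2 * M]mulrC -mulrA ler_wpM2l //; lra.
  have Y : 2 * M * m < K * m ^+ 4.
    have r3m : r ^+ 3 * m <= m ^+ 4.
      by rewrite [m ^+ 4]exprSr ler_pM2r // lerXn2r ?nnegrE // ltW.
    apply: (@lt_le_trans _ _ (K * (r ^+ 3 * m))); last by rewrite ler_pM2l.
    by rewrite mulrA ltr_pM2r //; lra.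
  by lra.
have := Hb m1; rewrite leNgt => /negP; apply.
have m2 : m <= m ^+ 2 by rewrite expr2 ler_peMr // ltW.
have X : M * (m + m ^+ 2) <= 2 * M * m ^+ 2.
  by rewrite [2 * M]mulrC -mulrA ler_wpM2l //; lra.
have Y : 2 * M * m ^+ 2 < K * m ^+ 2.
  rewrite ltr_pM2r ?exprn_gt0 //.
  have : K * r ^+ 3 <= K by rewrite ler_piMr // ltW.
  by lra.
by lra.
Qed.

Lemma model_coercive (al1 al2 y11 y12 y22 b a : R) :
  exists2 K0, 0 < K0 & forall K s : R, K0 <= K -> exists B, forall h1 h2 z t q : R,
    0 <= q -> model_low al1 al2 y11 y12 y22 b a h1 h2 z t
      + model_high K h1 h2 z t + q <= s ->
    [/\ `|h1| <= B, `|h2| <= B, `|z| <= B, `|t| <= B & q <= B].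
Proof.
have [M M0 HM] := model_low_bound al1 al2 y11 y12 y22 b a.
exists (2 * M + 1); first by rewrite ltr_wpDl // mulr_ge0.
(* For m >= 1 the excess of K over 2 M leaves m <= m^2 <= s, so m <= B1 in every case. The bound on
   q follows, since the high part is nonnegative and the low part is now bounded below. *)
move=> K s KM; pose B1 := 1 + `|s|.
exists (B1 + `|s| + M * (B1 + B1 ^+ 2)) => h1 h2 z t q q0 Ps.
have K0 : 0 < K by lra.
have [m [H1 H2 Hz Ht [Ha Hb]]] := model_high_bound h1 h2 z t (ltW K0).
have low := HM _ _ _ _ _ H1 H2 Hz Ht.
have s0 := normr_ge0 s; have ss := ler_norm s.
have m0 : 0 <= m by apply: le_trans H1.
have m2 := sqr_ge0 m.
have mB : m <= B1.
  case: (leP m 1) => [m1|/ltW m1]; first by rewrite /B1; lra.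
  have := Hb m1; have mm : m <= m ^+ 2 by rewrite expr2 ler_peMr.
  have X : M * (m + m ^+ 2) <= 2 * M * m ^+ 2.
    by rewrite [2 * M]mulrC -mulrA ler_wpM2l //; lra.
  have Y : (2 * M + 1) * m ^+ 2 <= K * m ^+ 2 by rewrite ler_wpM2r.
  by rewrite /B1; lra.
have B10 : 0 <= B1 by rewrite /B1; lra.
have high0 : 0 <= model_high K h1 h2 z t.
  case: (leP m 1) => [m1|/ltW m1].
    by apply: le_trans (Ha m1); rewrite mulr_ge0 ?exprn_ge0 // ltW.
  by apply: le_trans (Hb m1); rewrite mulr_ge0 // ltW.
have lowB : M * (m + m ^+ 2) <= M * (B1 + B1 ^+ 2).
  by rewrite ler_wpM2l // lerD // lerXn2r ?nnegrE.
have MB0 : 0 <= M * (B1 + B1 ^+ 2) by rewrite mulr_ge0 // addr_ge0 // sqr_ge0.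
move: lowB MB0; move: (M * (B1 + B1 ^+ 2)) => X lowB MB0.
by split; lra.
Qed.

End model_growth.

(** * Left-translated coordinates around a base point *)

Section left_coordinates.
Context (R : realType).
Implicit Types (x y : spacetime R).
Local Notation O := (@heis_pos_time R).
Let oO : open O := @open_heis_pos_time R.

Lemma heis_pos_time_gt0 x : O x -> 0 < x.2.
Proof. by case. Qed.

Lemma partial_coord k (i : 'I_3) x :
  partial k (fun y => y.1 0 i) x = (coord_dir R k).1 0 i.
Proof. by case: (is_derive_coord i (coord_dir R k) x). Qed.

Lemma partial_time k x : partial k (fun y => y.2) x = (coord_dir R k).2.
Proof. by case: (is_derive_time (coord_dir R k) x). Qed.

Lemma hder_coord0 : hder O (fun x => x.1 0 0) (fun=> 1) (fun=> 0) (fun=> 0).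
Proof.
split=> [|x Ox]; first exact: smooth_on_coord.
by rewrite !horizXE !partial_coord /= !mxE /= mulr0 !mulr0 !addr0.
Qed.

Lemma hder_coord1 : hder O (fun x => x.1 0 1) (fun=> 0) (fun=> 1) (fun=> 0).
Proof.
split=> [|x Ox]; first exact: smooth_on_coord.
by rewrite !horizXE !partial_coord /= !mxE /= mulr0 !mulr0 !addr0.
Qed.

Lemma hder_coord2 : hder O (fun x => x.1 0 2)
  (fun x => - (x.1 0 1 / 2)) (fun x => x.1 0 0 / 2) (fun=> 0).
Proof.
split=> [|x Ox]; first exact: smooth_on_coord.
by rewrite !horizXE !partial_coord /hcoef /= !mxE /= !mulr1 !add0r.
Qed.

Lemma hder_time : hder O (fun x => x.2) (fun=> 0) (fun=> 0) (fun=> 1).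
Proof.
split=> [|x Ox]; first exact: smooth_on_time.
by rewrite !horizXE !partial_time /= mulr0 !mulr0 !addr0.
Qed.

Lemma hder_timeV : hder O (fun x => x.2^-1) (fun=> 0) (fun=> 0)
  (fun x => - (x.2^-1 * x.2^-1)).
Proof.
have t0 x : O x -> x.2 != 0 by move=> /heis_pos_time_gt0/lt0r_neq0.
split=> [|x Ox]; first by apply: smooth_onV => //; exact: smooth_on_time.
have P k : partial k (fun y => y.2^-1) x =
    - (x.2^-1 * x.2^-1) * (coord_dir R k).2.
  have [td E] := is_derive_time (coord_dir R k) x.
  rewrite /partial deriveV ?t0 // E.
  by rewrite /GRing.scale /= expr2 invfM.
by rewrite !horizXE !P /= !(mulr0, addr0, mulr1).
Qed.

(** X1 and X2 are left-invariant, so they act on [lh1], [lh2], [lz] as on the coordinates at the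
    origin. Subtractions are spelled as sums to fit the rules for [hder]. *)
Definition lh1 (x0 x : spacetime R) : R := x.1 0 0 + - x0.1 0 0.
Definition lh2 (x0 x : spacetime R) : R := x.1 0 1 + - x0.1 0 1.
(* the third coordinate of x0^-1 x *)
Definition lz (x0 x : spacetime R) : R :=
  x.1 0 2 + - x0.1 0 2
  + 2^-1 * (x0.1 0 1 * x.1 0 0) + (- 2^-1) * (x0.1 0 0 * x.1 0 1).
Definition ltau (x0 x : spacetime R) : R := x.2 + - x0.2.
(** The barrier tau^2 / t blows up as t -> 0 and vanishes to second order at the base time, where it
    leaves the time derivative unchanged. *)
Definition lq (x0 x : spacetime R) : R := (ltau x0 x * ltau x0 x) * x.2^-1.
Definition ldq (x0 x : spacetime R) : R :=
  (ltau x0 x * ltau x0 x) * - (x.2^-1 * x.2^-1) + x.2^-1 * (2 * ltau x0 x).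

Ltac hder_tac2 :=
  repeat first [exact: hder_cst | exact hder_coord0 | exact hder_coord1
    | exact hder_coord2 | exact hder_time | exact hder_timeV
    | apply: (hderD oO) | apply: (hderM oO)].

Variable x0 : spacetime R.

Lemma hder_lh1 : hder O (lh1 x0) (fun=> 1) (fun=> 0) (fun=> 0).
Proof.
by apply: eq_hder; [rewrite /lh1; hder_tac2|move=> x _ /=; rewrite !addr0].
Qed.

Lemma hder_lh2 : hder O (lh2 x0) (fun=> 0) (fun=> 1) (fun=> 0).
Proof.
by apply: eq_hder; [rewrite /lh2; hder_tac2|move=> x _ /=; rewrite !addr0].
Qed.

Lemma hder_ltau : hder O (ltau x0) (fun=> 0) (fun=> 0) (fun=> 1).
Proof.
by apply: eq_hder; [rewrite /ltau; hder_tac2|move=> x _ /=; rewrite !addr0].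
Qed.

Lemma hder_lz : hder O (lz x0) (fun x => - 2^-1 * lh2 x0 x)
  (fun x => 2^-1 * lh1 x0 x) (fun=> 0).
Proof.
apply: eq_hder; first by rewrite /lz; hder_tac2.
move=> x _ /=; rewrite /lh1 /lh2.
move: (x.1 0 0) (x.1 0 1) (x0.1 0 0) (x0.1 0 1) => A B C D.
by split; field.
Qed.

Lemma hder_lq : hder O (lq x0) (fun=> 0) (fun=> 0) (ldq x0).
Proof.
apply: eq_hder.
  rewrite /lq; apply: (hderM oO); last exact: hder_timeV.
  by apply: (hderM oO); exact: hder_ltau.
move=> x _; rewrite /ldq; move: (ltau x0 x) (x.2^-1) => A B.
by split; ring.
Qed.

Lemma left_coords0 : [/\ lh1 x0 x0 = 0, lh2 x0 x0 = 0, lz x0 x0 = 0,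
  ltau x0 x0 = 0 & lq x0 x0 = 0 /\ ldq x0 x0 = 0].
Proof.
have T : ltau x0 x0 = 0 by rewrite /ltau subrr.
rewrite /lh1 /lh2 /lz /lq /ldq T !subrr; split=> //.
  by move: (x0.1 0 0) (x0.1 0 1) => A B; ring.
by split; ring.
Qed.

Lemma left_coords_eq x : lh1 x0 x = 0 -> lh2 x0 x = 0 -> lz x0 x = 0 ->
  ltau x0 x = 0 -> x = x0.
Proof.
move=> /subr0_eq E0 /subr0_eq E1 E2 /subr0_eq Et.
have {}E2 : x.1 0 2 = x0.1 0 2.
  move: E2; rewrite /lz E0 E1; move: (x0.1 0 0) (x0.1 0 1) (x.1 0 2) => A B C.
  by move: (x0.1 0 2) => D; lra.
case: x x0 E0 E1 E2 Et => [p s] [p0 s0] /= E0 E1 E2 ->; congr pair.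
by apply/rowP => i; have [->|->|->] := ord3P i.
Qed.

Lemma lq_ge0 x : O x -> 0 <= lq x0 x.
Proof.
by move=> /heis_pos_time_gt0 t0; rewrite mulr_ge0 ?invr_ge0 ?(ltW t0) // -expr2 sqr_ge0.
Qed.

Lemma coord_left x : [/\ coord (Some 0) x - coord (Some 0) x0 = lh1 x0 x,
  coord (Some 1) x - coord (Some 1) x0 = lh2 x0 x,
  coord None x - coord None x0 = ltau x0 x &
  coord (Some 2) x - coord (Some 2) x0 =
    lz x0 x + 2^-1 * (x0.1 0 0 * lh2 x0 x - x0.1 0 1 * lh1 x0 x)].
Proof.
split=> //; rewrite /= /lz /lh1 /lh2.
by move: (x.1 0 0) (x.1 0 1) (x.1 0 2) (x0.1 0 0) (x0.1 0 1) (x0.1 0 2) => *; ring.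
Qed.

Lemma left_box_near (A : set (spacetime R)) : nbhs x0 A ->
  exists2 r : R, 0 < r & forall x, `|lh1 x0 x| < r -> `|lh2 x0 x| < r ->
    `|lz x0 x| < r -> `|ltau x0 x| < r -> A x.
Proof.
(* By [coord_left] the third coordinate differs from [lz] by multiples of [lh1] and [lh2] with
   coefficients x0/2; the factor B absorbs them. *)
move=> /nbhs_box[r r0 rA]; pose B := 1 + `|x0.1 0 0| + `|x0.1 0 1|.
have B1 : 1 <= B by rewrite /B -addrA lerDl addr_ge0.
have B0 : 0 < B by apply: lt_le_trans B1.
have rB : r / B <= r by rewrite ler_pdivrMr // ler_peMr // ltW.
have rBB : r / B * B = r by rewrite divfK // gt_eqF.
exists (r / B); first by rewrite divr_gt0.
move=> x H1 H2 Hz Ht; apply: rA; have [E0 E1 Et E2] := coord_left x.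
case=> [i|]; last by rewrite Et (lt_le_trans Ht).
have [->|->|->] := ord3P i.
- by rewrite E0 (lt_le_trans H1).
- by rewrite E1 (lt_le_trans H2).
rewrite E2; move: rBB H1 H2 Hz; rewrite /B.
move: (lz x0 x) (lh1 x0 x) (lh2 x0 x) (r / _) => Z A1 A2 s rBB H1 H2 Hz.
have s0 : 0 < s by apply: le_lt_trans Hz.
have X1 : `|x0.1 0 0 * A2| <= `|x0.1 0 0| * s by rewrite normrM ler_wpM2l // ltW.
have X2 : `|x0.1 0 1 * A1| <= `|x0.1 0 1| * s by rewrite normrM ler_wpM2l // ltW.
have N0 : 0 <= `|x0.1 0 0| * s by rewrite mulr_ge0 // ltW.
have N1 : 0 <= `|x0.1 0 1| * s by rewrite mulr_ge0 // ltW.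
move: X1 X2 Hz; rewrite !ler_norml !ltr_norml => /andP[? ?] /andP[? ?] /andP[? ?].
by apply/andP; split; lra.
Qed.

End left_coordinates.

(** * Taylor expansion in left-translated coordinates *)

Section left_taylor.
Context (R : realType).
Local Notation O := (@heis_pos_time R).
Let oO : open O := @open_heis_pos_time R.

(** Young's inequality m h y <= (e/2) h^2 + m^2/(2e) y^2: second-order terms containing z or t cost
    only a small multiple of |h|^2, the rest going into z^2 + t^2. *)
Lemma cross_terms_bound (m1 m2 m3 m4 m5 m6 m7 e : R) : 0 < e ->
  exists2 C, 0 <= C & forall h1 h2 z t : R,
    m1 * (h1 * z) + m2 * (h2 * z) + m3 * (z * z) + m4 * (z * t)
      + m5 * (h1 * t) + m6 * (h2 * t) + m7 * (t * t)
    <= e * (h1 * h1 + h2 * h2) + C * (z * z + t * t).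
Proof.
move=> e0; pose w (m : R) := (2 * e)^-1 * (m * m).
have w0 m : 0 <= w m.
  apply: mulr_ge0; last by rewrite -expr2 sqr_ge0.
  by rewrite invr_ge0 mulr_ge0 // ltW.
exists (w m1 + w m2 + w m5 + w m6 + `|m3| + `|m4| + `|m7|).
  by rewrite !addr_ge0.
move=> h1 h2 z t.
have sq (x : R) : 0 <= x * x by rewrite -expr2 sqr_ge0.
have young (m h y : R) : m * (h * y) <= 2^-1 * e * (h * h) + w m * (y * y).
  have := sq (e * h - m * y).
  rewrite -(pmulr_rge0 _ (_ : 0 < (2 * e)^-1)) ?invr_gt0 ?mulr_gt0 // => H.
  rewrite -subr_ge0; apply: le_trans H _; rewrite le_eqVlt; apply/orP; left.
  by apply/eqP; rewrite /w; field; rewrite gt_eqF.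
have diag (m y : R) : m * (y * y) <= `|m| * (y * y).
  by rewrite ler_wpM2r // ler_norm.
have mix (m y x : R) : m * (y * x) <= `|m| * (y * y + x * x).
  apply: le_trans (ler_norm _) _; rewrite normrM ler_wpM2l //.
  have := sq (y - x); have := sq (y + x); have := sq y; have := sq x.
  by rewrite ler_norml => *; apply/andP; split; lra.
have := young m1 h1 z; have := young m2 h2 z; have := young m5 h1 t.
have := young m6 h2 t; have := diag m3 z; have := diag m7 t; have := mix m4 z t.
have p1 := mulr_ge0 (w0 m1) (sq t); have p2 := mulr_ge0 (w0 m2) (sq t).
have p5 := mulr_ge0 (w0 m5) (sq z); have p6 := mulr_ge0 (w0 m6) (sq z).
have p3 := mulr_ge0 (normr_ge0 m3) (sq t).
have p7 := mulr_ge0 (normr_ge0 m7) (sq z).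
move: p1 p2 p5 p6 p3 p7.
move: (w m1) (w m2) (w m5) (w m6) `|m3| `|m4| `|m7| => *.
by lra.
Qed.

(** Converts the Taylor remainder, expressed in coordinate differences, into left coordinates; z +
    c0 h1 + c1 h2 is the third difference, and 4 comes from Cauchy-Schwarz on four terms. *)
Lemma sum_norm_sqr_bound (c0 c1 : R) : exists2 B, 0 < B &
  forall h1 h2 z t : R,
    (`|h1| + `|h2| + `|z + c0 * h1 + c1 * h2| + `|t|) ^+ 2
    <= B * (h1 * h1 + h2 * h2 + (z * z + t * t)).
Proof.
pose G := 1 + `|c0| + `|c1|.
have G0 : 0 < G by rewrite /G -addrA ltr_wpDr // addr_ge0.
exists (4 * (G * G)); first by rewrite !mulr_gt0.
move=> h1 h2 z t.
have tri : `|z + c0 * h1 + c1 * h2| <= `|z| + `|c0| * `|h1| + `|c1| * `|h2|.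
  by rewrite -!normrM; do 2 (apply: le_trans (ler_normD _ _) _; apply: lerD => //).
have sq v : `|v| * `|v| = v * v :> R by rewrite -!expr2 real_normK ?num_real.
rewrite -(sq h1) -(sq h2) -(sq z) -(sq t).
have n1 := normr_ge0 h1; have n2 := normr_ge0 h2; have nz := normr_ge0 z.
have nt := normr_ge0 t; have k0 := normr_ge0 c0; have k1 := normr_ge0 c1.
have nv := normr_ge0 (z + c0 * h1 + c1 * h2).
apply: (@le_trans _ _ ((G * (`|h1| + `|h2| + `|z| + `|t|)) ^+ 2)).
  rewrite lerXn2r ?nnegrE ?addr_ge0 //.
    by rewrite mulr_ge0 ?(ltW G0) // !addr_ge0.
  apply: (le_trans (y := `|h1| + `|h2| + (`|z| + `|c0| * `|h1| + `|c1| * `|h2|) + `|t|)).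
    by rewrite lerD2r lerD2l.
  rewrite /G; move: `|c0| `|c1| `|h1| `|h2| `|z| `|t| n1 n2 nz nt k0 k1.
  move=> a b x y u v x0 y0 u0 v0 a0 b0.
  have := mulr_ge0 a0 y0; have := mulr_ge0 a0 u0; have := mulr_ge0 a0 v0.
  have := mulr_ge0 b0 x0; have := mulr_ge0 b0 u0; have := mulr_ge0 b0 v0.
  by lra.
rewrite [4 * _]mulrC -mulrA -expr2 exprMn ler_pM2l ?exprn_gt0 //.
move: `|h1| `|h2| `|z| `|t| => x y u v; rewrite expr2.
have := sqr_ge0 (x - y); have := sqr_ge0 (x - u); have := sqr_ge0 (x - v).
have := sqr_ge0 (y - u); have := sqr_ge0 (y - v); have := sqr_ge0 (u - v).
by lra.
Qed.

Lemma horizX2E i j (phi : spacetime R -> R) x : smooth_on O phi -> O x ->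
  horizX i (horizX j phi) x =
  horizX i (partial (Some (widen_ord (leqnSn 2) j)) phi) x
  + (hcoef j x * horizX i (partial (Some 2) phi) x
     + partial (Some 2) phi x * horizX i (hcoef j) x).
Proof.
move=> Cphi Ox.
have C k := smooth_on_partial k Cphi.
have Ch := smooth_on_hcoef oO j.
rewrite (horizX_congr oO i (fun y _ => horizXE j phi y) Ox).
rewrite (horizXD i (C _) (smooth_onM oO Ch (C _)) Ox).
by rewrite (horizXM i Ch (C _) Ox).
Qed.

Lemma horizX_hcoef i j (x : spacetime R) : O x ->
  horizX i (hcoef j) x = 2^-1 * ((i == 0) && (j == 1))%:R
    - 2^-1 * ((i == 1) && (j == 0))%:R.
Proof.
move=> Ox.
have H0 : hder O (hcoef 0) (fun=> 0) (fun=> - 2^-1) (fun=> 0).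
  rewrite (_ : hcoef 0 = fun x => - 2^-1 * x.1 0 1); last first.
    by apply/funext => y; rewrite /hcoef /= mulNr mulrC.
  apply: eq_hder; first exact: (hderM oO (hder_cst oO _) (@hder_coord1 R)).
  by move=> y _; split; rewrite !mulr0 ?mulr1 addr0.
have H1 : hder O (hcoef 1) (fun=> 2^-1) (fun=> 0) (fun=> 0).
  rewrite (_ : hcoef 1 = fun x => 2^-1 * x.1 0 0); last first.
    by apply/funext => y; rewrite /hcoef /= mulrC.
  apply: eq_hder; first exact: (hderM oO (hder_cst oO _) (@hder_coord0 R)).
  by move=> y _; split; rewrite !mulr0 ?mulr1 addr0.
have I2 (k : 'I_2) : k = 0 \/ k = 1.
  by case: k => -[|[|]] // hk; [left|right]; apply: val_inj.
have [_ /(_ x Ox)[E00 E10 _]] := H0; have [_ /(_ x Ox)[E01 E11 _]] := H1.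
by case: (I2 i) (I2 j) => -> [] ->; rewrite ?E00 ?E10 ?E01 ?E11 /=;
  rewrite ?mulr0 ?mulr1 ?subr0 ?sub0r.
Qed.

(** With c0, c1 the coefficients of d/dp_3 in X1, X2 at the base point, substituting v turns the
    Taylor polynomial into one whose coefficients are the horizontal gradient and symmetrized
    Hessian, up to cross terms with z or t. *)
Lemma left_second_order_identity (c0 c1 F0 F1 F2 F3 D00 D01 D02 D03 D10 D11 D12 D13
    D20 D21 D22 D23 D30 D31 D32 D33 h1 h2 z t v : R) : v = z + c0 * h1 + c1 * h2 ->
  h1 * F0 + h2 * F1 + v * F2 + t * F3 + 2^-1 * (
    h1 * (h1 * D00 + h2 * D01 + v * D02 + t * D03)
    + h2 * (h1 * D10 + h2 * D11 + v * D12 + t * D13)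
    + v * (h1 * D20 + h2 * D21 + v * D22 + t * D23)
    + t * (h1 * D30 + h2 * D31 + v * D32 + t * D33)) =
  model_low (F0 + c0 * F2) (F1 + c1 * F2)
    (D00 + c0 * D02 + c0 * (D20 + c0 * D22))
    (2^-1 * (D10 + c0 * D12 + c1 * (D20 + c0 * D22)
      + D01 + c1 * D02 + c0 * (D21 + c1 * D22)))
    (D11 + c1 * D12 + c1 * (D21 + c1 * D22)) F2 F3 h1 h2 z t
  + (2^-1 * (D02 + D20 + 2 * c0 * D22) * (h1 * z)
    + 2^-1 * (D12 + D21 + 2 * c1 * D22) * (h2 * z)
    + 2^-1 * D22 * (z * z) + 2^-1 * (D23 + D32) * (z * t)
    + 2^-1 * (D03 + D30 + c0 * (D23 + D32)) * (h1 * t)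
    + 2^-1 * (D13 + D31 + c1 * (D23 + D32)) * (h2 * t)
    + 2^-1 * D33 * (t * t)).
Proof. by move=> ->; rewrite /model_low; field. Qed.

(* The partial derivatives are named D and F: comparing them up to conversion is
   expensive. *)
Lemma horizX2_value i j i' j' (phi : spacetime R -> R) x
    (F : option 'I_3 -> R) (D : option 'I_3 -> option 'I_3 -> R) :
  widen_ord (leqnSn 2) i = i' -> widen_ord (leqnSn 2) j = j' ->
  (forall k, partial k phi x = F k) ->
  (forall k l, partial l (partial k phi) x = D k l) ->
  smooth_on O phi -> O x -> horizX i (horizX j phi) x =
    D (Some j') (Some i') + hcoef i x * D (Some j') (Some 2)
    + hcoef j x * (D (Some 2) (Some i') + hcoef i x * D (Some 2) (Some 2))
    + F (Some 2) * (2^-1 * ((i == 0) && (j == 1))%:R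
        - 2^-1 * ((i == 1) && (j == 0))%:R).
Proof.
move=> <- <- HF HD Cphi Ox; rewrite -!HD -!HF.
rewrite (horizX2E i j Cphi Ox) (horizX_hcoef i j Ox).
by rewrite (horizXE i (partial (Some _) phi)) (horizXE i (partial (Some 2) phi)) addrA.
Qed.

Lemma taylor2_le_value (phi : spacetime R -> R) x (e : R)
    (F : option 'I_3 -> R) (D : option 'I_3 -> option 'I_3 -> R) :
  (forall k, partial k phi x = F k) ->
  (forall k l, partial l (partial k phi) x = D k l) ->
  smooth_on O phi -> O x -> 0 < e ->
  \forall y \near x,
    phi y <= phi x + csum (fun k => coord k (y - x) * F k)
      + 2^-1 * csum (fun k => coord k (y - x) *
          csum (fun j => coord j (y - x) * D k j))
      + e * csum (fun k => `|coord k (y - x)|) ^+ 2.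
Proof.
move=> HF HD Cphi Ox e0; apply: filterS (taylor2_le oO (Cphi 2%N) Ox e0) => y H.
apply: le_trans H _; rewrite le_eqVlt; apply/orP; left; apply/eqP.
congr (_ + _ + _ * _ + _); apply: eq_csum => k; first by rewrite HF.
by congr (_ * _); apply: eq_csum => j; rewrite HD.
Qed.

Lemma left_taylor (phi : spacetime R -> R) (x0 : spacetime R) (e : R) :
  smooth_on O phi -> O x0 -> 0 < e ->
  exists2 C, 0 <= C & \forall x \near x0,
    phi x <= phi x0 + model_low (gradH phi x0 0 0) (gradH phi x0 0 1)
        (hessH phi x0 0 0) (hessH phi x0 0 1) (hessH phi x0 1 1)
        (partial (Some 2) phi x0) (partial None phi x0)
        (lh1 x0 x) (lh2 x0 x) (lz x0 x) (ltau x0 x)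
      + e * (lh1 x0 x * lh1 x0 x + lh2 x0 x * lh2 x0 x)
      + C * (lz x0 x * lz x0 x + ltau x0 x * ltau x0 x).
Proof.
move=> Cphi Ox e0.
pose c0 := hcoef 0 x0; pose c1 := hcoef 1 x0.
have [F HF] : exists F, forall k, partial k phi x0 = F k.
  by exists (fun k => partial k phi x0).
have [D HD] : exists D, forall k j, partial j (partial k phi) x0 = D k j.
  by exists (fun k j => partial j (partial k phi) x0).
rewrite (HF (Some 2)) (HF None).
have E : [/\ gradH phi x0 0 0 = F (Some 0) + c0 * F (Some 2),
    gradH phi x0 0 1 = F (Some 1) + c1 * F (Some 2),
    hessH phi x0 0 0 = D (Some 0) (Some 0) + c0 * D (Some 0) (Some 2)
      + c0 * (D (Some 2) (Some 0) + c0 * D (Some 2) (Some 2)),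
    hessH phi x0 0 1 = 2^-1 * (D (Some 1) (Some 0) + c0 * D (Some 1) (Some 2)
      + c1 * (D (Some 2) (Some 0) + c0 * D (Some 2) (Some 2))
      + D (Some 0) (Some 1) + c1 * D (Some 0) (Some 2)
      + c0 * (D (Some 2) (Some 1) + c1 * D (Some 2) (Some 2))) &
    hessH phi x0 1 1 = D (Some 1) (Some 1) + c1 * D (Some 1) (Some 2)
      + c1 * (D (Some 2) (Some 1) + c1 * D (Some 2) (Some 2))].
  have W0 : widen_ord (leqnSn 2) 0 = 0 :> 'I_3 by apply: val_inj.
  have W1 : widen_ord (leqnSn 2) 1 = 1 :> 'I_3 by apply: val_inj.
  have H00 := horizX2_value W0 W0 HF HD Cphi Ox.
  have H01 := horizX2_value W0 W1 HF HD Cphi Ox.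
  have H10 := horizX2_value W1 W0 HF HD Cphi Ox.
  have H11 := horizX2_value W1 W1 HF HD Cphi Ox.
  have -> : gradH phi x0 0 0 = F (Some 0) + c0 * F (Some 2).
    by rewrite mxE horizXE W0 -!HF.
  have -> : gradH phi x0 0 1 = F (Some 1) + c1 * F (Some 2).
    by rewrite mxE horizXE W1 -!HF.
  have Hij i j : hessH phi x0 i j = 2^-1 * (horizX i (horizX j phi) x0
    + horizX j (horizX i phi) x0) by rewrite mxE.
  rewrite !Hij H00 H01 H10 H11 /= -/c0 -/c1 {H00 H01 H10 H11 HD HF Hij}.
  move: (D (Some 0) (Some 0)) (D (Some 0) (Some 1)) (D (Some 0) (Some 2)).
  move: (D (Some 1) (Some 0)) (D (Some 1) (Some 1)) (D (Some 1) (Some 2)).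
  move: (D (Some 2) (Some 0)) (D (Some 2) (Some 1)) (D (Some 2) (Some 2)).
  move: (F (Some 0)) (F (Some 1)) (F (Some 2)).
  move: c0 c1 => {}c0 {}c1 *.
  by split=> //; field.
have e20 : 0 < e / 2 by rewrite divr_gt0.
have [B B0 HB] := sum_norm_sqr_bound c0 c1.
have [C C0 HC] := @cross_terms_bound
  (2^-1 * (D (Some 0) (Some 2) + D (Some 2) (Some 0) + 2 * c0 * D (Some 2) (Some 2)))
  (2^-1 * (D (Some 1) (Some 2) + D (Some 2) (Some 1) + 2 * c1 * D (Some 2) (Some 2)))
  (2^-1 * D (Some 2) (Some 2))
  (2^-1 * (D (Some 2) None + D None (Some 2)))
  (2^-1 * (D (Some 0) None + D None (Some 0) + c0 * (D (Some 2) None + D None (Some 2))))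
  (2^-1 * (D (Some 1) None + D None (Some 1) + c1 * (D (Some 2) None + D None (Some 2))))
  (2^-1 * D None None) (e / 2) e20.
(* Half of e pays for the cross terms and half for the remainder; the latter also contributes e/2 to
   the coefficient of z^2 + tau^2. *)
have e'0 : 0 < e / 2 / B by rewrite !divr_gt0.
exists (C + e / 2); first by rewrite addr_ge0 // divr_ge0 // ltW.
apply: filterS (taylor2_le_value HF HD Cphi Ox e'0) => x.
have [E0 E1 Et E2] := coord_left x0 x.
have {}E2 : coord (Some 2) x - coord (Some 2) x0 =
    lz x0 x + c0 * lh1 x0 x + c1 * lh2 x0 x.
  rewrite E2 /c0 /c1 /hcoef /=; move: (lz _ _) (lh1 _ _) (lh2 _ _) => *.
  by move: (x0.1 0 0) (x0.1 0 1) => *; field.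
rewrite /csum !coordB E0 E1 E2 Et => H; apply: le_trans H _.
have [-> -> -> -> ->] := E.
rewrite -(addrA (phi x0)).
rewrite (@left_second_order_identity c0 c1 _ _ _ _ _ _ _ _ _ _ _ _ _ _ _ _ _ _ _ _
  _ _ (lz x0 x) _ _ erefl).
have := HC (lh1 x0 x) (lh2 x0 x) (lz x0 x) (ltau x0 x).
have := HB (lh1 x0 x) (lh2 x0 x) (lz x0 x) (ltau x0 x).
move: (model_low _ _ _ _ _ _ _ _ _ _ _) (phi x0) => LOW P.
move: (lh1 x0 x) (lh2 x0 x) (lz x0 x) (ltau x0 x) => h1 h2 z t.
move: (_ ^+ 2) => N HN HR.
have HN2 : e / 2 / B * N <= e / 2 * (h1 * h1 + h2 * h2 + (z * z + t * t)).
  have -> : e / 2 * (h1 * h1 + h2 * h2 + (z * z + t * t)) =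
      e / 2 / B * (B * (h1 * h1 + h2 * h2 + (z * z + t * t))).
    by field; rewrite gt_eqF.
  by rewrite ler_pM2l.
by lra.
Qed.

End left_taylor.

(** * Coercive models at the contact point *)

Section contact.
Context (R : realType).
Local Notation O := (@heis_pos_time R).
Let oO : open O := @open_heis_pos_time R.
Implicit Types (x : spacetime R) (u phi : spacetime R -> R).

Definition lmodel x0 (al1 al2 y11 y12 y22 b a K : R) : spacetime R -> R :=
  model (lh1 x0) (lh2 x0) (lz x0) (ltau x0) (lq x0) al1 al2 y11 y12 y22 b a K.

Lemma lmodelE x0 al1 al2 y11 y12 y22 b a K x :
  lmodel x0 al1 al2 y11 y12 y22 b a K x =
  model_low al1 al2 y11 y12 y22 b a (lh1 x0 x) (lh2 x0 x) (lz x0 x) (ltau x0 x)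
  + model_high K (lh1 x0 x) (lh2 x0 x) (lz x0 x) (ltau x0 x) + lq x0 x.
Proof. by rewrite /lmodel /model /model_low /model_high !addrA. Qed.

Lemma compact_left_box x0 (B t1 : R) : 0 < t1 ->
  exists C, [/\ compact C, C `<=` O & forall x, `|lh1 x0 x| <= B ->
    `|lh2 x0 x| <= B -> `|lz x0 x| <= B -> `|ltau x0 x| <= B -> t1 <= x.2 -> C x].
Proof.
move=> t10.
pose r i : R := `|coord i x0| + `|B| * (1 + `|x0.1 0 0| + `|x0.1 0 1|).
exists ([set p : heis R | forall i : 'I_3, `[- r (Some i), r (Some i)]%classic (p 0 i)]
  `*` `[t1, r None]%classic); split.
- apply: compact_setX; last exact: segment_compact.
  apply: (@rV_compact _ _ (fun i : 'I_3 => `[- r (Some i), r (Some i)]%classic)).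
  by move=> i; exact: segment_compact.
- move=> [p t] [_ /=]; rewrite in_itv /= => /andP[t1t _].
  by split=> //=; apply: lt_le_trans t1t.
move=> x H1 H2 Hz Ht tt.
have [E0 E1 Et E2] := coord_left x0 x.
have BB := ler_norm B.
have n0 := normr_ge0 (x0.1 0 0); have n1 := normr_ge0 (x0.1 0 1).
have nB := normr_ge0 B.
have p0 : 0 <= `|B| * `|x0.1 0 0| by rewrite mulr_ge0.
have p1 : 0 <= `|B| * `|x0.1 0 1| by rewrite mulr_ge0.
have X1 : `|x0.1 0 0 * lh2 x0 x| <= `|B| * `|x0.1 0 0|.
  by rewrite normrM mulrC ler_wpM2r // (le_trans H2).
have X2 : `|x0.1 0 1 * lh1 x0 x| <= `|B| * `|x0.1 0 1|.
  by rewrite normrM mulrC ler_wpM2r // (le_trans H1).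
have main (c c0 d : R) : c - c0 = d ->
    `|d| <= `|B| * (1 + `|x0.1 0 0| + `|x0.1 0 1|) ->
    - (`|c0| + `|B| * (1 + `|x0.1 0 0| + `|x0.1 0 1|)) <= c <=
    `|c0| + `|B| * (1 + `|x0.1 0 0| + `|x0.1 0 1|).
  move=> cd; rewrite ler_norml => /andP[d1 d2].
  have := ler_norm c0; have := ler_norm (- c0); rewrite normrN => ? ?.
  by apply/andP; split; lra.
have b (d : R) : `|d| <= B -> `|d| <= `|B| * (1 + `|x0.1 0 0| + `|x0.1 0 1|).
  by move=> dB; lra.
split; last first.
  rewrite /= in_itv /= tt /=; have := main _ _ _ Et (b _ Ht).
  by move=> /andP[_].
move=> i; rewrite /= in_itv /=.
have [->|->|->] := ord3P i.
- exact: main E0 (b _ H1).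
- exact: main E1 (b _ H2).
apply: (main _ _ _ E2).
move: X1 X2 (le_trans Hz BB); rewrite !ler_norml.
move=> /andP[? ?] /andP[? ?] /andP[? ?].
by apply/andP; split; lra.
Qed.

Lemma lmodel_coercive x0 (al1 al2 y11 y12 y22 b a : R) : O x0 ->
  exists2 K0, 0 < K0 & forall K s : R, K0 <= K ->
    exists C, [/\ compact C, C `<=` O & forall x, O x ->
      lmodel x0 al1 al2 y11 y12 y22 b a K x <= s -> C x].
Proof.
move=> Ox0; have t00 := heis_pos_time_gt0 Ox0.
have [K0 K00 HK] := model_coercive al1 al2 y11 y12 y22 b a.
exists K0 => // K s /(HK K s)[B HB].
(* From q <= B one gets tau^2 <= B t; if t < x0.2 / 2, then tau^2 >= x0.2^2 / 4, which bounds t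
   below. The added 1 keeps the denominator positive. *)
pose t1 := Num.min (x0.2 / 2) (x0.2 ^+ 2 / (4 * (`|B| + 1))).
have B1 : 0 < `|B| + 1 by rewrite ltr_wpDl.
have t10 : 0 < t1 by rewrite lt_min !divr_gt0 ?exprn_gt0 ?mulr_gt0.
have [C [cC CO HC]] := @compact_left_box x0 B t1 t10.
exists C; split=> // x Ox; rewrite lmodelE => Px.
have t0 := heis_pos_time_gt0 Ox.
have [H1 H2 Hz Ht Hq] := HB _ _ _ _ _ (lq_ge0 x0 Ox) Px.
apply: HC => //; rewrite ge_min; case: (leP (x0.2 / 2) x.2) => //= xs.
move: Hq; rewrite /lq ler_pdivrMr // => Hq.
rewrite ler_pdivrMr ?mulr_gt0 //.
have BB : B * x.2 <= `|B| * x.2 by rewrite ler_wpM2r ?ler_norm // ltW.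
have sq : x0.2 ^+ 2 / 4 <= ltau x0 x * ltau x0 x.
  have -> : x0.2 ^+ 2 / 4 = (x0.2 / 2) * (x0.2 / 2) by field.
  rewrite /ltau -[leRHS]mulrNN opprD opprK; apply: ler_pM; lra.
by lra.
Qed.

Lemma continuous_near_lt (f : spacetime R -> R) x (c : R) :
  {for x, continuous f} -> f x < c -> \forall y \near x, f y < c.
Proof. by move=> cf fc; apply: (cf [set t | t < c]); exact: lt_nbhsl. Qed.

Lemma hder_lmodel x0 (al1 al2 y11 y12 y22 b a K : R) :
  smooth_on O (lmodel x0 al1 al2 y11 y12 y22 b a K).
Proof.
by have [] := hder_model oO (hder_lh1 x0) (hder_lh2 x0) (hder_lz x0)
  (hder_ltau x0) (hder_lq x0) al1 al2 y11 y12 y22 b a K.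
Qed.

Lemma lmodel_base x0 (al1 al2 y11 y12 y22 b a K : R) :
  lmodel x0 al1 al2 y11 y12 y22 b a K x0 = 0.
Proof.
rewrite lmodelE; have [-> -> -> -> [-> _]] := left_coords0 x0.
by rewrite /model_low /model_high !(mulr0, addr0).
Qed.

Lemma lmodel_derivatives_base x0 (al1 al2 y11 y12 y22 b a K : R) : O x0 ->
  let f := lmodel x0 al1 al2 y11 y12 y22 b a K in
  [/\ gradH f x0 0 0 = al1, gradH f x0 0 1 = al2, partial None f x0 = a &
   [/\ hessH f x0 0 0 = y11, hessH f x0 0 1 = y12, hessH f x0 1 0 = y12 &
     hessH f x0 1 1 = y22]].
Proof.
move=> Ox0 f.
have [G1 G2] := gradH_model oO (hder_lh1 x0) (hder_lh2 x0) (hder_lz x0)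
  (hder_ltau x0) (hder_lq x0) al1 al2 y11 y12 y22 b a K Ox0.
have P := partial_model oO (hder_lh1 x0) (hder_lh2 x0) (hder_lz x0)
  (hder_ltau x0) (hder_lq x0) al1 al2 y11 y12 y22 b a K Ox0.
have [H1 H2 H3 H4] := hessH_model oO (hder_lh1 x0) (hder_lh2 x0) (hder_lz x0)
  (hder_ltau x0) (hder_lq x0) al1 al2 y11 y12 y22 b a K Ox0.
rewrite /f /lmodel G1 G2 P H3 H1 H2 H4 /model1 /model2 /model0.
have [-> -> -> -> [_ ->]] := left_coords0 x0.
by rewrite !(mulr0, addr0, subr0).
Qed.

(** In dimension two the projection orthogonal to eta has trace 1, so adding d times the identity
    lowers the operator by exactly d. *)
Lemma mcf_op_shift (eta : 'rV[R]_2) (Y Z : 'M[R]_2) (d : R) : eta != 0 ->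
  Z 0 0 = Y 0 0 + d -> Z 0 1 = Y 0 1 -> Z 1 0 = Y 1 0 -> Z 1 1 = Y 1 1 + d ->
  mcf_op eta Z = mcf_op eta Y - d.
Proof.
rewrite rV2_neq0 => /lt0r_neq0 e0 Z1 Z2 Z3 Z4; rewrite !mcf_opE Z1 Z2 Z3 Z4.
by field.
Qed.

(* The superlevel set {u >= u x0} touches {phi >= phi x0} from inside at x0; near
   x0 it then touches {model >= 0} from inside as well. *)
Lemma touching_near u phi x0 (e r0 : R) : smooth_on O phi -> O x0 -> 0 < e ->
  0 < r0 ->
  (\forall x \near x0, phi x < phi x0 -> u x < u x0) ->
  exists C r, [/\ 0 <= C, 0 < r, r <= 1, r <= r0 & forall x,
    [/\ `|lh1 x0 x| < r, `|lh2 x0 x| < r, `|lz x0 x| < r & `|ltau x0 x| < r] ->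
    u x0 <= u x ->
    0 <= model_low (gradH phi x0 0 0) (gradH phi x0 0 1)
        (hessH phi x0 0 0) (hessH phi x0 0 1) (hessH phi x0 1 1)
        (partial (Some 2) phi x0) (partial None phi x0)
        (lh1 x0 x) (lh2 x0 x) (lz x0 x) (ltau x0 x)
      + e * (lh1 x0 x * lh1 x0 x + lh2 x0 x * lh2 x0 x)
      + C * (lz x0 x * lz x0 x + ltau x0 x * ltau x0 x)].
Proof.
move=> Cphi Ox0 e0 r00 side.
have [C C0 HT] := left_taylor Cphi Ox0 e0.
have [r r1 Hr] := left_box_near (filterI side HT).
exists C, (Num.min (Num.min r 1) r0); split=> //.
- by rewrite !lt_min r1 ltr01 r00.
- by rewrite !ge_min lexx !orbT.
- by rewrite !ge_min lexx !orbT.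
move=> x [H1 H2 Hz Ht] ux.
have mr (v : R) : v < Num.min (Num.min r 1) r0 -> v < r.
  by rewrite !lt_min => /andP[/andP[]].
have [sx Tx] := Hr x (mr _ H1) (mr _ H2) (mr _ Hz) (mr _ Ht).
have px : phi x0 <= phi x.
  by rewrite leNgt; apply/negP => /sx; rewrite ltNge ux.
have := le_trans px Tx; rewrite -!addrA lerDl; exact.
Qed.

End contact.

(** * Contradiction at regular and at degenerate contact points *)

Section level_set_comparison.
Context (R : realType).
Local Notation O := (@heis_pos_time R).
Let oO : open O := @open_heis_pos_time R.
Implicit Types (x : spacetime R) (u phi : spacetime R -> R).

(** With a nonzero gradient the Hessian may be enlarged slightly, which makes x0 the only contact
    point; strictness is then needed there only and spreads by continuity. *)
Lemma contact_regular u phi x0 : (forall x, O x -> {for x, continuous u}) ->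
  visc_sub O u -> smooth_on O phi -> O x0 ->
  (\forall x \near x0, phi x < phi x0 -> u x < u x0) ->
  gradH phi x0 != 0 ->
  ~ 0 < partial None phi x0 + mcf_op (gradH phi x0) (hessH phi x0).
Proof.
move=> cu hu Cphi Ox0 side g0 S0.
(* Shifting the Hessian by 4 e costs S/2, so the model keeps S/2 > 0; the shift adds 2 e |h|^2 to
   the model, twice the Taylor error. *)
set S := _ + _ in S0; pose e := S / 8.
have e0 : 0 < e by rewrite divr_gt0.
have [C [r [C0 r0 r1 _ touch]]] := touching_near Cphi Ox0 e0 ltr01 side.
move: touch; set al1 := gradH phi x0 0 0; set al2 := gradH phi x0 0 1.
set y11 := hessH phi x0 0 0; set y12 := hessH phi x0 0 1.
set y22 := hessH phi x0 1 1; set b := partial (Some 2) phi x0.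
set a := partial None phi x0 => touch.
have [K1 K10 HK1] := lmodel_coercive al1 al2 (y11 + 4 * e) y12 (y22 + 4 * e) b a Ox0.
have [K2 K20 HK2] := model_confined al1 al2 (y11 + 4 * e) y12 (y22 + 4 * e) b a r0 r1.
(* [K1] makes the model coercive, [K2] confines {Psi <= 0} to the box where [touch] applies, and C +
   1 exceeds the Taylor constant. *)
pose K := K1 + K2 + C + 1.
have KK1 : K1 <= K by rewrite /K; lra.
have KK2 : K2 <= K by rewrite /K; lra.
pose Psi := lmodel x0 al1 al2 (y11 + 4 * e) y12 (y22 + 4 * e) b a K.
apply: (@barrier _ O u Psi x0 oO cu hu) => //.
- exact: hder_lmodel.
- by move=> s; apply: HK1.
- exact: lmodel_base.
move=> x Ox Px ux.
suff -> : x = x0.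
  have [G1 G2 P0 [H00 H01 H10 H11]] := lmodel_derivatives_base
    al1 al2 (y11 + 4 * e) y12 (y22 + 4 * e) b a K Ox0.
  have gE : gradH Psi x0 = gradH phi x0.
    apply/rowP => i; have [->|->] : i = 0 \/ i = 1.
      by case: i => -[|[|]] // hi; [left|right]; apply: val_inj.
    - exact: G1.
    - exact: G2.
  apply: (strict_super_near oO (hder_lmodel _ _ _ _ _ _ _ _ _) Ox0); rewrite -/Psi gE //.
  rewrite (@mcf_op_shift _ _ (hessH phi x0) _ (4 * e)) //; last first.
    by rewrite H10 /y12 !mxE addrC.
  rewrite P0 -/a addrA -/S.
  by rewrite /e; lra.
move: Px; rewrite /Psi lmodelE => Px.
have q0 := lq_ge0 x0 Ox.
have low_le : model_low al1 al2 (y11 + 4 * e) y12 (y22 + 4 * e) b a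
    (lh1 x0 x) (lh2 x0 x) (lz x0 x) (ltau x0 x)
  + model_high K (lh1 x0 x) (lh2 x0 x) (lz x0 x) (ltau x0 x) <= 0.
  by apply: le_trans Px; rewrite lerDl.
have := touch x (HK2 _ _ _ _ _ KK2 low_le) ux.
move: low_le (@left_coords_eq _ x0 x).
move: (lh1 x0 x) (lh2 x0 x) (lz x0 x) (ltau x0 x) => h1 h2 z t low_le EQ.
rewrite /model_low /model_high in low_le * => T.
have sq (v : R) : 0 <= v * v by rewrite -expr2 sqr_ge0.
have n0 : 0 <= h1 * h1 + h2 * h2 by rewrite addr_ge0.
have w0 : 0 <= z * z + t * t by rewrite addr_ge0.
have nn : 0 <= K * ((h1 * h1 + h2 * h2) * (h1 * h1 + h2 * h2)).
  by rewrite mulr_ge0 // /K !addr_ge0 // ltW.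
have Kw : (C + 1) * (z * z + t * t) <= K * (z * z + t * t).
  by rewrite ler_wpM2r // /K; lra.
(* Psi <= 0 bounds the low part of phi above by -2 e |h|^2 - (C + 1) (z^2 + t^2), while contact
   bounds it below by - e |h|^2 - C (z^2 + t^2). *)
have D : e * (h1 * h1 + h2 * h2) + (z * z + t * t) <= 0.
  by move: nn Kw T low_le; lra.
have en0 := mulr_ge0 (ltW e0) n0.
have nE : h1 * h1 + h2 * h2 = 0.
  have /eqP : e * (h1 * h1 + h2 * h2) = 0 by apply/eqP; rewrite eq_le en0 andbT; lra.
  by rewrite mulf_eq0 (gt_eqF e0) /= => /eqP.
have wE : z * z + t * t = 0 by apply/eqP; rewrite eq_le w0 andbT; lra.
have split0 (v w : R) : v * v + w * w = 0 -> v = 0 /\ w = 0.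
  move/eqP; rewrite paddr_eq0 // !mulf_eq0 !orbb => /andP[/eqP -> /eqP ->] //.
by have [? ?] := split0 _ _ nE; have [? ?] := split0 _ _ wE; apply: EQ.
Qed.

(** Here n = |h|^2 and w = z^2 + tau^2. As K >= 2 C + 1, half of K w absorbs C w, leaving K n^2 + K
    w / 2 <= e n; this gives K n <= e and then K^2 w <= 2 e^2. *)
Lemma degenerate_estimate (e C K n w low : R) : 0 < e -> 0 <= C ->
  2 * C + 1 <= K -> 0 <= n -> 0 <= w ->
  0 <= low + e * n + C * w -> low + (K * (n * n) + K * w) <= 0 ->
  K * n <= e /\ (K * K) * w <= 2 * (e * e).
Proof.
move=> e0 C0 KC n0 w0 H1 H2.
have K0 : 0 < K by lra.
have Kw : 0 <= (K - (2 * C + 1)) * w by rewrite mulr_ge0 // subr_ge0.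
have H3 : K * (n * n) + 2^-1 * (K * w) <= e * n by move: Kw H1 H2; lra.
have Kww : 0 <= K * w by rewrite mulr_ge0 // ltW.
have Kn : K * n <= e.
  have [->|nn0] := eqVneq n 0; first by rewrite mulr0 ltW.
  have np : 0 < n by rewrite lt_neqAle eq_sym nn0.
  rewrite -(ler_pM2r np) -mulrA; lra.
split=> //.
have Kn0 : 0 <= K * n by rewrite mulr_ge0 // ltW.
have X : K * (2^-1 * (K * w)) <= K * (e * n).
  rewrite ler_pM2l //; have : 0 <= K * (n * n) by rewrite mulr_ge0 ?(ltW K0) // mulr_ge0.
  by lra.
have Y : e * (K * n) <= e * e by rewrite ler_pM2l.
by lra.
Qed.

Lemma norm_bound_of_sqr (e K z t : R) : 0 < e ->
  (K * K) * (z * z + t * t) <= 2 * (e * e) -> K * `|t| < 3 * e.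
Proof.
move=> e0 H; rewrite ltNge; apply/negP => Kt.
have e3 : 0 <= 3 * e by rewrite mulr_ge0 // ltW.
have := ler_pM e3 e3 Kt Kt; rewrite [leRHS]mulrACA.
have -> : `|t| * `|t| = t * t by rewrite -!expr2 real_normK ?num_real.
have ee : 0 < e * e by rewrite mulr_gt0.
have zz : 0 <= (K * K) * (z * z) by rewrite mulr_ge0 // -expr2 sqr_ge0.
by move=> X; lra.
Qed.

(** The Hessian cannot be enlarged here, so contact points other than x0 remain. They lie so close
    to x0 on the scale set by K that the model is strict near each of them, by
    [strict_super_model]. *)
Lemma contact_degenerate u phi x0 : (forall x, O x -> {for x, continuous u}) ->
  visc_sub O u -> smooth_on O phi -> O x0 ->
  (\forall x \near x0, phi x < phi x0 -> u x < u x0) ->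
  gradH phi x0 = 0 -> hessH phi x0 = 0 -> ~ 0 < partial None phi x0.
Proof.
move=> cu hu Cphi Ox0 side g0 h0 a0.
pose e := partial None phi x0 / 100.
have e0 : 0 < e by rewrite divr_gt0.
have Cc f f1 f2 f0 x : hder O f f1 f2 f0 -> O x -> {for x, continuous f}.
  by move=> [Cf _]; apply: smooth_on_continuous.
have cdq x : O x -> {for x, continuous (ldq x0)}.
  have [Cq Hq] := hder_lq x0; move=> Ox.
  have H y : O y -> partial None (lq x0) y = ldq x0 y.
    by move=> Oy; have [] := Hq y Oy.
  exact: (continuous_congr oO H Ox
    (smooth_on_continuous oO (smooth_on_partial None Cq) Ox)).
have cndq x : O x -> {for x, continuous (fun y => `|ldq x0 y|)}.
  move=> Ox; apply: (@continuous_comp _ _ _ (ldq x0) (fun v : R => `|v|) x).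
    exact: cdq.
  exact: norm_continuous.
have dq_near : \forall x \near x0, `|ldq x0 x| < e.
  apply: continuous_near_lt; first exact: cndq.
  by have [_ _ _ _ [_ ->]] := left_coords0 x0; rewrite normr0.
(* The time derivative of [lq] is unaffected by K, so it is made small beforehand by restricting the
   box. *)
have [r0 r00 Hr0] := left_box_near dq_near.
have [C [r [C0 rp r1 rr0 touch]]] := touching_near Cphi Ox0 e0 r00 side.
move: touch; rewrite g0 h0 !mxE; set b := partial (Some 2) phi x0.
set a := partial None phi x0 => touch.
have [K1 K10 HK1] := lmodel_coercive 0 0 0 0 0 b a Ox0.
have [K2 K20 HK2] := model_confined 0 0 0 0 0 b a rp r1.
pose K := K1 + K2 + (2 * C + 1).
have KK1 : K1 <= K by rewrite /K; lra.
have KK2 : K2 <= K by rewrite /K; lra.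
have KC : 2 * C + 1 <= K by rewrite /K; lra.
have K0 : 0 < K by lra.
pose Psi := lmodel x0 0 0 0 0 0 b a K.
apply: (@barrier _ O u Psi x0 oO cu hu) => //.
- exact: hder_lmodel.
- by move=> s; apply: HK1.
- exact: lmodel_base.
move=> x Ox Px ux.
(* The three inequalities are strict, hence persist near x by continuity, which gives strictness on
   a neighbourhood. *)
suff [N1 N2 N3] : [/\ K * (lh1 x0 x * lh1 x0 x + lh2 x0 x * lh2 x0 x) < 2 * e,
    K * `|ltau x0 x| < 3 * e & `|ldq x0 x| < e].
  have c1 := Cc _ _ _ _ x (hder_lh1 x0) Ox; have c2 := Cc _ _ _ _ x (hder_lh2 x0) Ox.
  have ct := Cc _ _ _ _ x (hder_ltau x0) Ox.
  have M1 : \forall y \near x,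
      K * (lh1 x0 y * lh1 x0 y + lh2 x0 y * lh2 x0 y) < 2 * e.
    apply: continuous_near_lt N1; apply: continuousM; first exact: cst_continuous.
    exact: (continuousD (continuousM c1 c1) (continuousM c2 c2)).
  have M2 : \forall y \near x, K * `|ltau x0 y| < 3 * e.
    apply: continuous_near_lt N2; apply: continuousM; first exact: cst_continuous.
    apply: (@continuous_comp _ _ _ (ltau x0) (fun v : R => `|v|) x ct).
    exact: norm_continuous.
  have M3 : \forall y \near x, `|ldq x0 y| < e.
    by apply: continuous_near_lt N3; exact: cndq.
  apply: filterS (filterI (filterI M1 M2) (filterI M3 (near_open oO Ox))).
  move=> y [[L1 L2] [L3 Oy]].
  have ea : 100 * e <= a by rewrite /e mulrC divfK.
  exact: (strict_super_model oO (hder_lh1 x0) (hder_lh2 x0) (hder_lz x0)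
    (hder_ltau x0) (hder_lq x0) b erefl erefl erefl erefl erefl Oy K0 ea L1 L2 L3).
move: Px; rewrite /Psi lmodelE => Px.
have q0 := lq_ge0 x0 Ox.
have low_le : model_low 0 0 0 0 0 b a
    (lh1 x0 x) (lh2 x0 x) (lz x0 x) (ltau x0 x)
  + model_high K (lh1 x0 x) (lh2 x0 x) (lz x0 x) (ltau x0 x) <= 0.
  by apply: le_trans Px; rewrite lerDl.
have small := HK2 _ _ _ _ _ KK2 low_le.
have T := touch x small ux.
have dqx : `|ldq x0 x| < e.
  by case: small => *; apply: Hr0; apply: (lt_le_trans _ rr0).
have sq (v : R) : 0 <= v * v by rewrite -expr2 sqr_ge0.
have [D1 D2] := degenerate_estimate e0 C0 KC (addr_ge0 (sq _) (sq _))
  (addr_ge0 (sq _) (sq _)) T low_le.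
split=> //; first by lra.
exact: norm_bound_of_sqr D2.
Qed.

Lemma gradH_partials_eq0 phi x : (forall k, partial k phi x = 0) -> gradH phi x = 0.
Proof. by move=> p0; apply/rowP => i; rewrite !mxE horizXE !p0 mulr0 addr0. Qed.

(** Both u and -u have to pass the test because [theta] may reverse order: u - u x0 can have either
    sign on {phi < phi x0}. The function phi is kept in both cases. *)
Lemma visc_sub_comp (theta : R -> R) u :
  (forall x, O x -> {for x, continuous u}) ->
  visc_sub O u -> visc_sub O (fun x => - u x) ->
  visc_sub O (fun x => theta (u x)).
Proof.
move=> cu hu hNu phi x0 Cphi Ox0 xmax.
have cNu x : O x -> {for x, continuous (fun x => - u x)}.
  by move=> Ox; apply: continuousN; exact: cu.
have uc y : O y -> phi y < phi x0 -> u y <> u x0.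
  move=> Oy py uE; have := xmax y Oy; rewrite uE.
  by rewrite lerD2l lerN2 leNgt py.
have side k : partial k phi x0 != 0 ->
    (\forall x \near x0, phi x < phi x0 -> u x < u x0) \/
    (\forall x \near x0, phi x < phi x0 -> - u x < - u x0).
  move=> pk; case: (level_one_side oO (Cphi 1%N) Ox0 cu pk uc); first by left.
  by move=> H; right; apply: filterS H => y H /H; rewrite ltrN2.
split=> [g0|g0 h0]; rewrite leNgt; apply/negP => S0.
  (* A nonzero horizontal gradient forces some nonzero partial derivative, the direction needed by
     [level_one_side]; in the degenerate case it is the time direction. *)
  have [k pk] : exists k, partial k phi x0 != 0.
    apply: contrapT => nk; move/eqP: g0; apply; apply: gradH_partials_eq0 => k.
    by apply/eqP/negPn/negP => pk; apply: nk; exists k.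
  case: (side k pk) => H.
    exact: (contact_regular cu hu Cphi Ox0 H g0 S0).
  exact: (contact_regular cNu hNu Cphi Ox0 H g0 S0).
case: (side None (lt0r_neq0 S0)) => H.
  exact: (contact_degenerate cu hu Cphi Ox0 H g0 h0 S0).
exact: (contact_degenerate cNu hNu Cphi Ox0 H g0 h0 S0).
Qed.

End level_set_comparison.

(** * Passage between extended-real and real-valued solutions *)

Section extended_real_solutions.
Context (R : realType) (O : set (spacetime R)).
Hypothesis oO : open O.
Implicit Types (x : spacetime R) (f phi : spacetime R -> R).

Lemma lsc_on_near (u : spacetime R -> \bar R) x (a : R) : lsc_on O u -> O x ->
  (a%:E < u x)%E -> \forall y \near x, (a%:E < u y)%E.
Proof.
move=> lu Ox /(lu (x : subspace O)) [V].
rewrite -(nbhs_subspace_interior (near_open oO Ox)) => xV aV.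
apply: filterS (filterI xV (near_open oO Ox)) => y [Vy Oy].
by apply: aV; apply: Vy.
Qed.

Lemma continuous_lsc_on f : (forall x, O x -> {for x, continuous f}) ->
  lsc_on O (fun x => (f x)%:E).
Proof.
move=> cf x a; rewrite lte_fin => ax.
have [Ox|Ox] := pselect (O x).
  exists [set y | a < f y]; last by move=> y /=; rewrite lte_fin.
  rewrite -(nbhs_subspace_interior (near_open oO Ox)).
  by apply: (cf x Ox [set t | a < t]); exact: lt_nbhsr.
(* A point outside O is isolated in the subspace topology, so its singleton is a neighbourhood. *)
exists [set x]; last by move=> y ->; rewrite lte_fin.
have : globally [set x] [set x] by [].
rewrite (@nbhs_subspace_out (spacetime R : topologicalType) O x Ox); exact.
Qed.

Lemma lsc_usc_continuous (u : spacetime R -> \bar R) x :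
  lsc_on O u -> usc_on O u -> (forall x, O x -> u x \is a fin_num) -> O x ->
  {for x, continuous (fun y => fine (u y))}.
Proof.
move=> lu uu ufin Ox; apply/cvgrPdist_lt => e e0.
have ux : u x = (fine (u x))%:E by rewrite fineK // ufin.
have H1 : \forall y \near x, ((fine (u x) - e)%:E < u y)%E.
  by apply: lsc_on_near => //; rewrite [ltRHS]ux lte_fin ltrBlDr ltrDl.
have H2 : \forall y \near x, ((- (fine (u x) + e))%:E < - u y)%E.
  apply: (lsc_on_near uu) => //.
  by rewrite [in ltRHS]ux -EFinN lte_fin ltrN2 ltrDl.
apply: filterS (filterI (filterI H1 H2) (near_open oO Ox)) => y [[L1 L2] Oy].
move: L1 L2; have -> : u y = (fine (u y))%:E by rewrite fineK // ufin.
rewrite -EFinN !lte_fin ltrN2 /= => L1 L2.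
by rewrite ltr_norml; apply/andP; split; lra.
Qed.

Lemma partialN k f x : smooth_on O f -> O x ->
  partial k (fun y => - f y) x = - partial k f x.
Proof.
by move=> Cf Ox; case: (is_deriveN (smooth_on_is_derive k Cf Ox)).
Qed.

Lemma horizXN i f x : smooth_on O f -> O x ->
  horizX i (fun y => - f y) x = - horizX i f x.
Proof. by move=> Cf Ox; rewrite !horizXE !(partialN _ Cf Ox) mulrN opprD. Qed.

Lemma gradHN f x : smooth_on O f -> O x ->
  gradH (fun y => - f y) x = - gradH f x.
Proof. by move=> Cf Ox; apply/rowP => i; rewrite !mxE (horizXN _ Cf Ox). Qed.

Lemma hessHN f x : smooth_on O f -> O x ->
  hessH (fun y => - f y) x = - hessH f x.
Proof.
move=> Cf Ox; have H2 i j :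
    horizX i (horizX j (fun y => - f y)) x = - horizX i (horizX j f) x.
  rewrite (horizX_congr oO i (fun y Oy => horizXN j Cf Oy) Ox).
  exact: horizXN (smooth_on_horizX oO j Cf) Ox.
by apply/matrixP => i j; rewrite !mxE !H2 -opprD mulrN.
Qed.

Lemma subsolution_visc_sub (u : spacetime R -> \bar R) :
  (forall x, O x -> u x \is a fin_num) -> subsolution O u ->
  visc_sub O (fun x => fine (u x)).
Proof.
move=> ufin [_ _ hu] phi x Cphi Ox xmax; apply: hu => //; split=> //.
  by rewrite fin_numD ufin.
move=> y Oy; have := xmax y Oy; rewrite -(fineK (ufin x Ox)) -(fineK (ufin y Oy)).
by rewrite -!EFinB lee_fin.
Qed.

Lemma supersolution_visc_sub (u : spacetime R -> \bar R) :
  (forall x, O x -> u x \is a fin_num) -> supersolution O u ->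
  visc_sub O (fun x => - fine (u x)).
Proof.
move=> ufin [_ _ hu] phi x Cphi Ox xmax.
have [] := hu (fun y => - phi y) x (smooth_onN oO Cphi).
  split=> //; first by rewrite fin_numD ufin.
  move=> y Oy; have := xmax y Oy; rewrite -(fineK (ufin x Ox)) -(fineK (ufin y Oy)).
  by rewrite -!EFinB lee_fin /= => ?; lra.
rewrite (gradHN Cphi Ox) (hessHN Cphi Ox) (partialN _ Cphi Ox) mcf_opN.
rewrite oppr_eq0 -opprD !oppr_ge0 => H1 H2; split=> // g0 h0.
by apply: H2; rewrite ?g0 ?h0 oppr0.
Qed.

Lemma visc_sub_subsolution f : (forall x, O x -> {for x, continuous f}) ->
  visc_sub O f -> subsolution O (fun x => (f x)%:E).
Proof.
move=> cf hf; split.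
- rewrite /usc_on; under eq_fun do rewrite -EFinN.
  by apply: continuous_lsc_on => x Ox; apply: continuousN; exact: cf.
- by move=> x _; exact: ltry.
by move=> phi x Cphi [Ox _ xmax]; apply: hf.
Qed.

Lemma visc_sub_supersolution f : (forall x, O x -> {for x, continuous f}) ->
  visc_sub O (fun x => - f x) -> supersolution O (fun x => (f x)%:E).
Proof.
move=> cf hf; split.
- exact: continuous_lsc_on.
- by move=> x _; exact: ltNyr.
move=> phi x Cphi [Ox _ xmin].
have [] := hf (fun y => - phi y) x (smooth_onN oO Cphi) Ox.
  by move=> y Oy; have := xmin y Oy; rewrite -!EFinB lee_fin => ?; lra.
rewrite (gradHN Cphi Ox) (hessHN Cphi Ox) (partialN _ Cphi Ox) mcf_opN.
rewrite oppr_eq0 -opprD !oppr_le0 => H1 H2; split=> // g0 h0.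
by apply: H2; rewrite ?g0 ?h0 oppr0.
Qed.

End extended_real_solutions.

Unset Implicit Arguments.
Set Strict Implicit.

Theorem theorem7p1 (R : realType) (theta : R -> R) (htheta : continuous theta)
    (u : spacetime R -> \bar R) (hu : solution (@heis_pos_time R) u) :
  solution (@heis_pos_time R) (fun x => (theta (fine (u x)))%:E).
Proof.
have oO := @open_heis_pos_time R.
have [sub super] := hu; have [uusc ultoo _] := sub; have [ulsc ugtoo _] := super.
have ufin x : heis_pos_time x -> u x \is a fin_num.
  by move=> Ox; rewrite fin_real // ultoo // ugtoo.
have cu x : heis_pos_time x -> {for x, continuous (fun y => fine (u y))}.
  exact: lsc_usc_continuous.
have hsub := subsolution_visc_sub ufin sub.
have hsuper := supersolution_visc_sub oO ufin super.
have cw x : heis_pos_time x -> {for x, continuous (fun x => theta (fine (u x)))}.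
  move=> Ox; apply: (@continuous_comp _ _ _ (fun y => fine (u y)) theta x).
    exact: cu.
  exact: htheta.
split.
  exact: (visc_sub_subsolution oO cw (@visc_sub_comp R theta _ cu hsub hsuper)).
(* The supersolution property of [theta \o u] is the subsolution property of its opposite, that is,
   of (- theta) composed with u. *)
exact: (visc_sub_supersolution oO cw
  (@visc_sub_comp R (fun s => - theta s) _ cu hsub hsuper)).
Qed.
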